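(* Let $\mathcal{P}\in\mathcal{Q}_n$ be an irreducible, combinatorially symmetric sign pattern with a $0$-diagonal whose signed undirected graph $G$ has at least one cycle and no leaf, and suppose the distance between any two path-adjacent cycles in $G$ is odd. Then $\mathcal{P}$ is not consistent if any one of the following holds: (i) $G$ has a cycle $\mathcal{C}$ with at least two nonadjacent positively signed edges; (ii) $G$ has a cycle $\mathcal{C}$ with more than one maximal signed path of odd length; (iii) $G$ contains a cycle $\mathcal{C}$ of odd length having at least one positive edge.
   Context: A sign pattern is a matrix with entries in $\{+,-,0\}$; $\mathcal{Q}_n$ is the set of $n\times n$ sign patterns; $\mathcal{Q}(\mathcal{P})$ is the set of real matrices whose entries have the signs prescribed by $\mathcal{P}=[p_{ij}]$. $\mathcal{P}$ is combinatorially symmetric if $p_{ij}\ne0\iff p_{ji}\neq0$; $0$-diagonal means $p_{ii}=0$. Its signed undirected graph $G$ has vertices $1,\dots,n$, an edge $\{i,j\}$ ($i\neq j$) iff $p_{ij}\ne0$, signed $p_{ij}p_{ji}$. Cycles are simple cycles of length at least $3$. A leaf is a vertex of degree one. Two cycles $\mathcal{C}_1,\mathcal{C}_2$ of $G$ are path-adjacent if there is a path $u v_1\cdots v_r w$ in $G$ with $u\in V(\mathcal{C}_1)$, $w\in V(\mathcal{C}_2)$ and $v_1,\dots,v_r$ not vertices of any cycle of $G$; the distance between two cycles is the minimum distance (shortest path length) between a vertex of one and a vertex of the other. A maximal signed path of a cycle $\mathcal{C}$ is a maximal run of consecutive edges of $\mathcal{C}$ all of the same sign; its length is its number of edges. $\mathcal{P}$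 is consistent if there is $k$ such that every $A\in\mathcal{Q}(\mathcal{P})$ has exactly $k$ real eigenvalues (with algebraic multiplicity). *)

(* Defs.v *)
From mathcomp Require Import all_boot all_order all_algebra.
From mathcomp Require Import perm polyrcf.
From mathcomp Require Import reals.

Set Implicit Arguments.
Unset Strict Implicit.
Unset Printing Implicit Defensive.

Import Order.TTheory GRing.Theory Num.Theory.
Local Open Scope ring_scope.

Variant sign := Pos | Neg | Zero.

Definition sign_val (s : sign) : int :=
  match s with Pos => 1 | Neg => -1 | Zero => 0 end.
Coercion sign_val : sign >-> int.

Section SignPattern.
Context (n : nat).
Implicit Types (P : 'M[sign]_n) (i j u w x : 'I_n).

Definition zero_diagonal P := forall i, P i i = Zero.

Definition combinatorially_symmetric P :=
  forall i j, P i j <> Zero <-> P j i <> Zero.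

(* Some simultaneous row and column permutation brings [P] to block upper
   triangular form with two nonempty square diagonal blocks, of orders [k]
   and [n - k]. *)
Definition reducible P :=
  exists (s : 'S_n) (k : nat), (0 < k < n)%N /\
    forall i j, (k <= i)%N -> (j < k)%N -> P (s i) (s j) = Zero.

Definition irreducible_pattern P := ~ reducible P.

Definition qualitative_class (R : realType) P (A : 'M[R]_n) :=
  forall i j, sgz (A i j) = P i j.

(* [rootsR] lists each root once. *)
Definition num_real_eigenvalues (R : realType) (A : 'M[R]_n) : nat :=
  (\sum_(a <- rootsR (char_poly A)) mup a (char_poly A))%N.

Definition consistent (R : realType) P :=
  exists k : nat, forall A : 'M[R]_n,
    qualitative_class P A -> num_real_eigenvalues A = k.

(* This is the edge relation of the undirected graph of [P] when [P] is
   combinatorially symmetric. *)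
Definition adj P : rel 'I_n :=
  fun i j => (i != j) && ((P i j : int) != 0).

Definition edge_sign P i j : int := (P i j : int) * (P j i : int).

Definition leaf P i := #|[set j | adj P i j]| = 1%N.

(* A cycle is given by the list of its vertices in cyclic order, so a cycle
   of length m is given by 2m different lists; [cycle_edges] depends only on
   the cycle. *)
Definition graph_cycle P (c : seq 'I_n) :=
  (3 <= size c)%N /\ ucycle (adj P) c.

Definition arc_edge (c : seq 'I_n) x : {set 'I_n} := [set x; next c x].

Definition cycle_edges (c : seq 'I_n) : {set {set 'I_n}} :=
  [set arc_edge c x | x in c].

Definition graph_path P u (p : seq 'I_n) w :=
  [/\ path (adj P) u p, uniq (u :: p) & last u p = w].

(* The interior [v] may be empty: cycles joined by an edge are path-adjacent. *)
Definition path_adjacent P (c1 c2 : seq 'I_n) :=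
  exists u (v : seq 'I_n) w,
    [/\ u \in c1, w \in c2, graph_path P u (rcons v w) w &
        forall x, x \in v -> forall c, graph_cycle P c -> x \notin c].

Definition is_least (D : nat -> Prop) (d : nat) :=
  D d /\ forall k, D k -> (d <= k)%N.

Definition vertex_distance P u w : nat -> Prop :=
  is_least (fun k => exists p, graph_path P u p w /\ size p = k).

Definition cycle_distance P (c1 c2 : seq 'I_n) : nat -> Prop :=
  is_least (fun k => exists u w,
    [/\ u \in c1, w \in c2 & vertex_distance P u w k]).

Definition odd_path_adjacent_distances P :=
  forall c1 c2, graph_cycle P c1 -> graph_cycle P c2 ->
    cycle_edges c1 <> cycle_edges c2 -> path_adjacent P c1 c2 ->
    forall d, cycle_distance P c1 c2 d -> odd d.

Definition positive_arc P (c : seq 'I_n) x := 0 < edge_sign P x (next c x).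

(* Runs are compared as sets of edges; when all the edges of the cycle have
   the same sign, the only maximal run is the whole cycle. *)
Definition signed_run P (c : seq 'I_n) (F : {set {set 'I_n}}) :=
  exists (i l : nat) (s : int),
    [/\ (0 < l)%N,
        F = [set arc_edge c x | x in take l (rot i c)] &
        forall x, x \in take l (rot i c) -> edge_sign P x (next c x) = s].

Definition maximal_signed_path P (c : seq 'I_n) (F : {set {set 'I_n}}) :=
  signed_run P c F /\
  forall F', signed_run P c F' -> F \subset F' -> F' = F.

Definition two_nonadjacent_positive_edges P (c : seq 'I_n) :=
  exists x y, [/\ x \in c, y \in c, positive_arc P c x, positive_arc P c y &
    [disjoint arc_edge c x & arc_edge c y]].

Definition several_odd_maximal_signed_paths P (c : seq 'I_n) :=
  exists F1 F2, [/\ maximal_signed_path P c F1, maximal_signed_path P c F2,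
    F1 <> F2, odd #|F1| & odd #|F2|].

Definition odd_with_positive_edge P (c : seq 'I_n) :=
  odd (size c) /\ exists x, x \in c /\ positive_arc P c x.

End SignPattern.

(* Main.v *)
Require Import Defs.
From mathcomp Require Import all_boot all_order all_algebra.
From mathcomp Require Import reals.
From mathcomp Require Import fingroup perm polyrcf boolp topology normedtype derive.
From mathcomp Require Import ring lra zify.

(** Two distinct cycles of [G] with a common vertex are path-adjacent at
distance [0], which is even, so the cycles of [G] are vertex-disjoint. From a
vertex [v] off the cycles, every edge leads, along vertices off the cycles, to
a cycle, and joining two such paths at [v] gives a connection of odd length
between two path-adjacent cycles. Hence exactly one edge at [v] starts a path
of even length, and these edges match the vertices off the cycles. For a given
cycle [C], the other vertices therefore carry a permutation [rho] without fixed
points that moves every vertex along an edge.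

A permutation [s] that moves vertices along edges or fixes them gives a matrix
in the closure of the qualitative class, supported on the entries [(i, s i)],
whose characteristic polynomial is the product of [x^m - a] over the orbits of
[s]. With orbits scaled by distinct factors, its nonzero real roots are simple,
so that they persist under small perturbations; if [0] is not a root, no
further real root appears. Now compare two extensions of [rho] to [C]: going
around [C], which contributes at most [2] real eigenvalues ([1] if [C] is odd,
[0] if [C] is even and the product of the entries is negative), and swapping
the ends of one or two disjoint positive edges of [C], which contributes at
least [2] or [4]. In case (ii), when neither (i) nor (iii) applies, [C] is even
with a single positive edge, so the products of the entries in the two
directions around [C] have opposite signs. *)

Set Implicit Arguments.
Unset Strict Implicit.
Unset Printing Implicit Defensive.

Import Order.TTheory GRing.Theory Num.Theory.

(** * Vertices off the cycles *)

Section Graph.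
Variables (n : nat) (P : 'M[sign]_n).
Implicit Types (a b i j u v w x y z : 'I_n) (c p q : seq 'I_n).

Lemma uniq_size_le c : uniq c -> size c <= n.
Proof. by move=> uc; rewrite -(card_uniqP uc) -[leqRHS]card_ord max_card. Qed.

Lemma sign_val_neq0 (s : sign) : ((s : int) != 0)%R <-> s <> Zero.
Proof. by case: s. Qed.

Lemma adj_irrefl x : adj P x x = false.
Proof. by rewrite /adj eqxx. Qed.

Lemma graph_cycle_adj c x : graph_cycle P c -> x \in c -> adj P x (next c x).
Proof. by case=> _ /andP[cc _]; apply: next_cycle. Qed.

Lemma graph_cycle_uniq c : graph_cycle P c -> uniq c.
Proof. by case=> _ /andP[]. Qed.

Definition on_cycle x := exists2 c, graph_cycle P c & x \in c.

Definition adj_avoiding v : rel 'I_n := fun x y => [&& adj P x y, x != v & y != v].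

Lemma path_connect_avoiding v x p y : path (adj P) x p -> v \notin x :: p ->
  y \in x :: p -> connect (adj_avoiding v) x y.
Proof.
move=> xp vp; apply: path_connect.
have /sub_in_path -> // : {in predC1 v &, subrel (adj P) (adj_avoiding v)}.
  by move=> a b; rewrite !inE => av bv ab; apply/and3P.
by apply/allP => z zp; apply: contraNneq vp => <-.
Qed.

Lemma cycle_connect_avoiding v c x y : graph_cycle P c -> v \notin c ->
  x \in c -> y \in c -> connect (adj_avoiding v) x y.
Proof.
move=> [_ /andP[cc _]] vc; apply: connect_cycle.
have /sub_in_cycle -> // : {in predC1 v &, subrel (adj P) (adj_avoiding v)}.
  by move=> a b; rewrite !inE => av bv ab; apply/and3P.
by apply/allP => z zp; apply: contraNneq vc => <-.
Qed.

(** A vertex of [c1] lies on an edge of [c1], which is also an edge of [c2] and so has both ends on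
    [c2]. *)
Lemma mem_cycle_edges_eq c1 c2 x : graph_cycle P c2 ->
  cycle_edges c1 = cycle_edges c2 -> x \in c1 -> x \in c2.
Proof.
move=> gc2 e12 xc1; have : arc_edge c1 x \in cycle_edges c2.
  by rewrite -e12; apply: imset_f.
case/imsetP => y yc2 /setP/(_ x); rewrite !inE eqxx /= => /esym /orP[/eqP->//|/eqP->].
by rewrite mem_next.
Qed.

Hypothesis hsym : combinatorially_symmetric P.

Lemma adj_sym : symmetric (adj P).
Proof.
move=> i j; rewrite /adj eq_sym; congr (_ && _).
by apply/idP/idP => /sign_val_neq0 /hsym /sign_val_neq0.
Qed.

Lemma connect_avoiding_sym v : connect_sym (adj_avoiding v).
Proof.
by apply: sym_connect_sym => x y; rewrite /adj_avoiding adj_sym [(x != v) && _]andbC.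
Qed.

(** Edges at a vertex off the cycles are bridges: a path from [a] to [b] that avoids [v] would close
    up through [v] into a cycle. *)
Lemma off_cycle_bridge v a b : ~ on_cycle v -> adj P v a -> adj P v b ->
  connect (adj_avoiding v) a b -> a = b.
Proof.
move=> Nv va vb /connectP[p0 p0P bE]; apply: contra_notP Nv => ab.
case: (shortenP p0P) bE => p pP up _ bE.
have /= vp : v \notin a :: p.
  rewrite inE negb_or; apply/andP; split; first by apply: contraTneq va => ->; rewrite adj_irrefl.
  apply/negP => /splitPr pE; case: pE pP => p1 p2.
  by rewrite cat_path /= /adj_avoiding eqxx !andbF.
exists (v :: a :: p); last exact: mem_head.
(* The closed path has at least three vertices, since an empty [p] would give [a = b]. *)
split; first by case: p bE {up vp pP} => //= ba; case: ab.
rewrite /ucycle -[uniq _]/((v \notin a :: p) && uniq (a :: p)) vp up andbT /= va rcons_path -bE adj_sym vb andbT.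
rewrite andbT /=; by apply: (sub_path _ pP) => x y /and3P[].
Qed.

(** * Paths from off-cycle vertices to the cycles, and the matching they determine *)

Section Exits.
Hypothesis hirr : irreducible_pattern P.
Hypothesis hleaf : forall i, ~ leaf P i.
Hypothesis hcycle : exists c, graph_cycle P c.

(** An isolated [x], moved to the first index by a transposition, would be a diagonal block of order
    [1] and make [P] reducible. *)
Lemma adj_exists x : exists y, adj P x y.
Proof.
apply: contrapT => Nx; apply: hirr.
have n_gt1 : 1 < n.
  have [c [c3 /andP[_ uc]]] := hcycle; apply: (leq_trans (ltnW c3)).
  exact: uniq_size_le.
pose o := Ordinal (ltnW n_gt1 : 0 < n).
exists (tperm o x), 1; split=> // i j i1 j1.
have -> : j = o by apply: val_inj => /=; lia.
rewrite tpermL; apply: contrapT => /sign_val_neq0 Px; apply: Nx.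
exists (tperm o x i); rewrite adj_sym /adj Px andbT.
rewrite -[x in _ != x](tpermL o x) (inj_eq perm_inj).
by apply: contraTneq i1 => ->.
Qed.

Lemma adj_exists_neq x z : exists2 y, adj P x y & y != z.
Proof.
apply: contrapT => Nx; have [y xy] := adj_exists x.
have Nz u : adj P x u -> u = z.
  by move=> xu; apply/eqP; apply: contra_notT Nx => uz; exists u.
apply: (@hleaf x); rewrite /leaf -(cards1 z); congr #|pred_of_set _|; apply/setP => u.
rewrite !inE; apply/idP/eqP => [/Nz//|->].
by rewrite -(Nz y).
Qed.

(* A path with [k] interior vertices, hence of length [k.+1], whose first step
   is the edge from [v] to [u]. *)
Definition exit v u (k : nat) := exists p w,
  [/\ path (adj P) v (rcons p w), uniq (v :: p), forall y, y \in p -> ~ on_cycle y,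
      on_cycle w & head w p = u /\ size p = k].

(** The path is prolonged by an edge other than the one it arrived by. It cannot return to itself,
    because the edges at [x] are bridges, so it stops at a cycle. The number [m] bounds the
    remaining steps, as a path has at most [n] vertices. *)
Lemma exit_extend v u m q x : n <= size q + m ->
    path (adj P) v (rcons q x) -> uniq (v :: rcons q x) ->
    (forall y, y \in rcons q x -> ~ on_cycle y) -> head x q = u ->
  exists k, exit v u k.
Proof.
elim: m q x => [|m IHm] q x nm qP uq Nq hu.
  by have := uniq_size_le uq; rewrite /= size_rcons; lia.
have [y xy yz] := adj_exists_neq x (last v q).
have hd z : head z (rcons q x) = u by case: q hu {nm qP uq Nq yz}.
have [yc|Ny] := pselect (on_cycle y).
  exists (size (rcons q x)), (rcons q x), y; split=> //.
  by rewrite rcons_path qP last_rcons.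
have Nx : ~ on_cycle x by apply: Nq; rewrite mem_rcons mem_head.
move: (qP); rewrite rcons_path => /andP[vq qx].
have xq : x \notin v :: q.
  by move: uq; rewrite -rcons_cons rcons_uniq => /andP[].
have yq : y \notin v :: rcons q x.
  rewrite -rcons_cons mem_rcons inE negb_or; apply/andP; split.
    by apply: contraTneq xy => ->; rewrite adj_irrefl.
  apply/negP => yq; case/eqP: yz.
  apply: (off_cycle_bridge Nx xy); first by rewrite adj_sym.
  apply: (@connect_trans _ _ v); last exact: path_connect_avoiding vq xq (mem_last _ _).
  by rewrite connect_avoiding_sym; exact: path_connect_avoiding vq xq yq.
apply: (IHm (rcons q x) y); rewrite ?size_rcons //; first lia.
- by rewrite rcons_path qP last_rcons.
- by rewrite -rcons_cons rcons_uniq yq.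
by move=> z; rewrite mem_rcons inE => /predU1P[->//|]; apply: Nq.
Qed.

Lemma exit_exists v u : ~ on_cycle v -> adj P v u -> exists k, exit v u k.
Proof.
move=> Nv vu; have [uc|Nu] := pselect (on_cycle u).
  by exists 0, [::], u; rewrite /= vu.
apply: (@exit_extend v u n [::] u) => //=; first by rewrite vu.
  by rewrite inE andbT; apply: contraTneq vu => ->; rewrite adj_irrefl.
by move=> y; rewrite inE => /eqP->.
Qed.

Hypothesis hodd : odd_path_adjacent_distances P.

Lemma exit_connect v u p w : ~ on_cycle v -> path (adj P) v (rcons p w) -> uniq (v :: p) ->
  on_cycle w -> head w p = u -> forall y, y \in rcons p w -> connect (adj_avoiding v) u y.
Proof.
move=> Nv vp up wc hu y; have vw : v != w by apply: contra_notN Nv => /eqP->.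
case: p vp up hu => [|a p] /= vp up hu; first by rewrite inE hu => /eqP->.
move: vp; rewrite hu => /andP[_ pP]; apply: path_connect_avoiding => //.
rewrite -hu -rcons_cons mem_rcons inE negb_or vw.
by case/andP: up.
Qed.

(** Every interior vertex [x] of the connection lies on any path [q] between the two cycles:
    otherwise the cycles and [q] would join the two neighbours of [x] on the connection while
    avoiding [x]. The end [w] of [q] is on a cycle, hence one further vertex. *)
Lemma bridge_path_length c1 c2 w1 w2 I : graph_cycle P c1 -> graph_cycle P c2 ->
    w1 \in c1 -> w2 \in c2 -> graph_path P w1 (rcons I w2) w2 ->
    (forall x, x \in I -> ~ on_cycle x) -> I != [::] ->
  forall u q w, u \in c1 -> w \in c2 -> graph_path P u q w -> size I < size q.
Proof.
move=> gc1 gc2 w1c w2c [IP uI _] NI I0 u q w uc wc [qP uq lq].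
have Ncyc x c y : x \in I -> graph_cycle P c -> y \in c -> x != y.
  by move=> /NI Nx gc yc; apply: contra_notN Nx => /eqP->; exists c.
have NcycP x c : x \in I -> graph_cycle P c -> x \notin c.
  by move=> xI gc; apply/negP => /(Ncyc x c x xI gc); rewrite eqxx.
have sub x : x \in I -> x \in q.
  move=> xI; apply: contraT => xq; have Nx := NI x xI.
  have xuq : x \notin u :: q by rewrite inE negb_or xq (Ncyc _ c1).
  have cuw : connect (adj_avoiding x) u w.
    by apply: (path_connect_avoiding qP xuq); rewrite -lq mem_last.
  have cw1 : connect (adj_avoiding x) w1 u by apply: cycle_connect_avoiding uc; rewrite ?NcycP.
  have cw2 : connect (adj_avoiding x) w w2 by apply: cycle_connect_avoiding w2c; rewrite ?NcycP.
  (* The detour around [x]: along [c1] to [u], along [q] to [w], along [c2] to [w2]. *)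
  have c12 := connect_trans cw1 (connect_trans cuw cw2).
  have [I1 [I2 IE]] : exists I1 I2, I = I1 ++ x :: I2.
    by case/splitPr: xI => I1 I2; exists I1, I2.
  move: IP uI; rewrite IE rcons_cat rcons_cons cat_path /=.
  move=> /and3P[P1 px P2]; rewrite mem_cat cat_uniq => /and3P[/norP[w1I1 w1x] uI1 /andP[/norP[xI1 dis] /andP[xI2 uI2]]].
  have P1x : x \notin w1 :: I1.
    by rewrite inE negb_or xI1 (Ncyc _ c1).
  have [b [I2' I2E]] : exists b I2', rcons I2 w2 = b :: I2'.
    by case: (I2) => [|b I2']; [exists w2, [::]|exists b, (rcons I2' w2)].
  move: P2; rewrite I2E /= => /andP[xb P2].
  have cb : connect (adj_avoiding x) b w2.
    apply: (path_connect_avoiding P2); first by rewrite -I2E.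
    by rewrite -I2E mem_rcons mem_head.
  have ca := path_connect_avoiding P1 P1x (mem_last w1 I1).
  have ab : last w1 I1 = b.
    apply: (off_cycle_bridge Nx); rewrite ?(adj_sym x) //; first by rewrite adj_sym.
    rewrite connect_avoiding_sym in ca; apply: connect_trans ca _.
    by apply: connect_trans c12 _; rewrite connect_avoiding_sym.
  have bI2 : b \in rcons I2 w2 by rewrite I2E mem_head.
  (* The vertex [b] would occur on the connection both before and after [x]. *)
  have := mem_last w1 I1; rewrite ab inE => /predU1P[bw1|bI1].
    by move: w1x; rewrite -bw1 inE bI2 orbT.
  by case/hasP: dis; exists b.
have wq : w \in q.
  case: (q) lq sub => [_ sub|z q' <- _]; last by rewrite /= mem_last.
  by case: (I) I0 sub => // x I' _ /(_ x (mem_head _ _)).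
have wI : w \notin I by apply/negP => /NI[]; exists c2.
have uwI : uniq (w :: I).
  by rewrite /= wI; move: uI; rewrite /= rcons_uniq => /and3P[].
by apply: uniq_leq_size uwI _ => z; rewrite inE => /predU1P[->//|/sub].
Qed.

(** The exits joined at [v] form a connection with [k1 + k2 + 1] interior vertices. By
    [bridge_path_length] its length [k1 + k2 + 2] is the distance of the two cycles, which is
    odd. *)
Lemma exits_parity v a b k1 k2 : ~ on_cycle v -> exit v a k1 -> exit v b k2 ->
  a != b -> odd (k1 + k2).
Proof.
move=> Nv [p1 [w1 [vp1 up1 N1 w1c [hd1 <-]]]] [p2 [w2 [vp2 up2 N2 w2c [hd2 <-]]]] ab.
have conn1 := exit_connect Nv vp1 up1 w1c hd1.
have conn2 := exit_connect Nv vp2 up2 w2c hd2.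
have va : adj P v a by move: vp1 hd1; case: (p1) => [|z p] /= /andP[vz _] <-.
have vb : adj P v b by move: vp2 hd2; case: (p2) => [|z p] /= /andP[vz _] <-.
(* The two exits lie in different components of [G] without [v]; in particular they are disjoint and
   end on different cycles. *)
have sep y z : y \in rcons p1 w1 -> z \in rcons p2 w2 -> ~ connect (adj_avoiding v) y z.
  move=> y1 z2 yz; case/eqP: ab; apply: (off_cycle_bridge Nv va vb).
  apply: connect_trans (conn1 y y1) (connect_trans yz _).
  by rewrite connect_avoiding_sym; apply: conn2.
have [c1 gc1 w1c1] := w1c; have [c2 gc2 w2c2] := w2c.
have vc c : graph_cycle P c -> v \notin c.
  by move=> gc; apply/negP => vc; apply: Nv; exists c.
have w1r : w1 \in rcons p1 w1 by rewrite mem_rcons mem_head.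
have w2r : w2 \in rcons p2 w2 by rewrite mem_rcons mem_head.
have c12 : cycle_edges c1 <> cycle_edges c2.
  move=> e12; apply: (sep w1 w2) => //.
  apply: (cycle_connect_avoiding gc2 (vc _ gc2) _ w2c2).
  exact: mem_cycle_edges_eq gc2 e12 w1c1.
pose I := rev p1 ++ v :: p2.
have IP : path (adj P) w1 (rcons I w2).
  rewrite /I rcons_cat rcons_cons -cat_rcons cat_path last_rcons vp2 andbT.
  have := rev_path (adj P) v (rcons p1 w1); rewrite last_rcons belast_rcons rev_cons => ->.
  by rewrite (eq_path (e' := adj P)) // => x y; rewrite adj_sym.
have vw1 : v != w1 by apply: contra_notN Nv => /eqP->.
have vw2 : v != w2 by apply: contra_notN Nv => /eqP->.
have uI : uniq (w1 :: rcons I w2).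
  have N1w : w1 \notin p1 by apply/negP => /N1.
  have N2w : w2 \notin p2 by apply/negP => /N2.
  have -> : w1 :: rcons I w2 = rev (rcons p1 w1) ++ v :: rcons p2 w2.
    by rewrite /I rcons_cat rcons_cons rev_rcons.
  move: up1 up2 => /= /andP[vp1' u1] /andP[vp2' u2].
  rewrite cat_uniq; apply/and3P; split.
  - by rewrite rev_uniq rcons_uniq N1w.
  - apply/hasPn => z; rewrite inE => z2; rewrite mem_rev; apply/negP => z1.
    case/predU1P: z2 => [zv|z2]; last by apply: (sep z z) => //; apply: connect0.
    by move: z1; rewrite zv mem_rcons inE (negPf vw1) (negPf vp1').
  by rewrite /= mem_rcons inE (negPf vw2) (negPf vp2') rcons_uniq N2w.
have NI x : x \in I -> ~ on_cycle x.
  by rewrite mem_cat mem_rev inE => /or3P[/N1|/eqP->|/N2].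
have gI : graph_path P w1 (rcons I w2) w2 by split; rewrite ?last_rcons.
have I0 : I != [::] by rewrite /I; case: (rev p1).
have len := bridge_path_length gc1 gc2 w1c1 w2c2 gI NI I0.
have : odd (size I).+1.
  apply: (hodd gc1 gc2 c12).
    exists w1, I, w2; split=> // x /NI Nx c gc; apply/negP => xc.
    by apply: Nx; exists c.
  split.
    exists w1, w2; split=> //; split; first by exists (rcons I w2); rewrite size_rcons.
    by move=> k [p [gp <-]]; apply: len gp.
  by move=> k [u [w [uc wc [[p [gp <-]] _]]]]; apply: len gp.
by rewrite /I size_cat size_rev /= addnS /= negbK.
Qed.

(** The path has length [k.+1], so odd [k] selects the edges that start a path of even length. *)
Definition matched v u := adj P v u /\ exists2 k, odd k & exit v u k.

(** There are at least two edges at [v], and exits through different edges have opposite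
    parities. *)
Lemma matched_exists v : ~ on_cycle v -> exists u, matched v u.
Proof.
move=> Nv; have [a va] := adj_exists v; have [b vb ba] := adj_exists_neq v a.
have [k1 e1] := exit_exists Nv va; have [k2 e2] := exit_exists Nv vb.
have := exits_parity Nv e2 e1 ba; rewrite oddD.
case o1 : (odd k1); first by exists a; split=> //; exists k1.
by rewrite addbF => o2; exists b; split=> //; exists k2.
Qed.

Lemma matched_unique v a b : ~ on_cycle v -> matched v a -> matched v b -> a = b.
Proof.
move=> Nv [_ [k1 o1 e1]] [_ [k2 o2 e2]]; apply/eqP; apply: contraT => ab.
by have := exits_parity Nv e1 e2 ab; rewrite oddD o1 o2.
Qed.

(** As [k] is odd, [u] is an interior vertex of the exit. The rest of this exit leaves [u] with an
    even number of interior vertices, so by [exits_parity] the exits from [u] through [v] have an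
    odd number. *)
Lemma matched_sym v u : ~ on_cycle v -> matched v u -> ~ on_cycle u /\ matched u v.
Proof.
move=> Nv [vu [k ok [p [w [vp up Np wc [hu sp]]]]]].
case: p sp vp up Np hu => [|u' p] /= sp vp up Np hu; first by rewrite -sp in ok.
move: vp up Np; rewrite hu => vp up Np {u' hu}.
have Nu : ~ on_cycle u by apply: Np; apply: mem_head.
move: vp => /andP[_ pP]; move: up => /and3P[vup uup upp].
have uv : adj P u v by rewrite adj_sym.
have e1 : exit u (head w p) (size p).
  exists p, w; split=> //; first by rewrite /= uup.
  by move=> y yp; apply: Np; rewrite inE yp orbT.
have [k2 e2] := exit_exists Nu uv.
have hv : head w p != v.
  case: (p) vup => [_|z p'] /=; first by apply: contra_notN Nv => /eqP <-.
  by rewrite !inE !negb_or => /and3P[_ + _]; rewrite eq_sym.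
split=> //; split=> //; exists k2 => //.
by have := exits_parity Nu e1 e2 hv; rewrite oddD; move: ok; rewrite -sp /=; case: (odd _).
Qed.

(* Cycles that meet are path-adjacent, through an edge of the second one, and
   are at the even distance [0]. *)
Lemma cycles_meet_eq c1 c2 x : graph_cycle P c1 -> graph_cycle P c2 ->
  x \in c1 -> x \in c2 -> c1 =i c2.
Proof.
move=> gc1 gc2 x1 x2; suff e12 : cycle_edges c1 = cycle_edges c2.
  by move=> y; apply/idP/idP; apply: mem_cycle_edges_eq.
apply: contrapT => e12.
suff : odd 0 by [].
apply: (hodd gc1 gc2 e12); last first.
  split=> //; exists x, x; split=> //; split=> //.
  by exists [::]; split.
exists x, [::], (next c2 x); rewrite mem_next; split=> //.
have xn := graph_cycle_adj gc2 x2.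
split=> //=; first by rewrite xn.
by rewrite inE andbT; apply: contraTneq xn => <-; rewrite adj_irrefl.
Qed.

(** Off the cycles [rho] is the matching, and on each other cycle it moves every vertex to its
    successor. These pieces fit together because distinct cycles are vertex-disjoint. *)
Lemma off_cycle_factor c : graph_cycle P c ->
  exists rho : 'I_n -> 'I_n, {in [predC c] &, injective rho} /\
    forall x, x \notin c -> adj P x (rho x) /\ rho x \notin c.
Proof.
move=> gc; pose is_cycle_set (S : {set 'I_n}) c' := graph_cycle P c' /\ [set x in c'] = S.
(* One list is chosen for each vertex set of a cycle, so that all its vertices use the same
   direction. The value [[::]] on other sets is a dummy. *)
have [cyc cycP] := choice (fun S : {set 'I_n} =>
  match pselect (exists c', is_cycle_set S c') return
    exists c0, (exists c', is_cycle_set S c') -> is_cycle_set S c0 with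
  | left ex => let: ex_intro c0 h := ex in ex_intro _ c0 (fun=> h)
  | right nex => ex_intro _ [::] (fun ex => False_ind _ (nex ex))
  end).
pose on_set x S := (exists c', is_cycle_set S c') /\ x \in cyc S.
have on_set_on_cycle x S : on_set x S -> on_cycle x.
  by move=> [/cycP[gS _] xS]; exists (cyc S).
have on_set_uniq x S T : on_set x S -> on_set x T -> S = T.
  move=> [/cycP[gS SE] xS] [/cycP[gT TE] xT]; rewrite -[LHS]SE -[RHS]TE; apply/setP => y.
  by rewrite !inE; apply: (cycles_meet_eq gS gT xS xT).
pose step x y := (~ on_cycle x /\ matched x y) \/ exists2 S, on_set x S & y = next (cyc S) x.
have [rho rhoP] : {rho & forall x, step x (rho x)}.
  apply: choice => x; have [xc|Nx] := pselect (on_cycle x); last first.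
    by have [y xy] := matched_exists Nx; exists y; left.
  have [c' gc' xc'] := xc; pose S := [set x in c'].
  have exS : exists c', is_cycle_set S c' by exists c'.
  exists (next (cyc S) x); right; exists S => //; split=> //.
  by have [_ /setP/(_ x)] := cycP S exS; rewrite !inE xc'.
have next_on x S : on_set x S -> on_set (next (cyc S) x) S.
  by move=> [exS xS]; split=> //; rewrite mem_next.
exists rho; split=> [x y xc yc xy|x xc].
  (* The mixed cases are impossible: partners are off the cycles, successors are on them. *)
  have := rhoP x; have := rhoP y; rewrite -xy => -[[Ny my]|[T yT yE]] [[Nx mx]|[S xS xE]].
  - have [Nr rx] := matched_sym Nx mx; have [_ ry] := matched_sym Ny my.
    exact: matched_unique rx ry.
  - have [Nr _] := matched_sym Ny my; case: Nr; rewrite xE.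
    exact: on_set_on_cycle (next_on _ _ xS).
  - have [Nr _] := matched_sym Nx mx; case: Nr; rewrite yE.
    exact: on_set_on_cycle (next_on _ _ yT).
  have ST : S = T.
    by apply: (on_set_uniq (rho x)); [rewrite xE|rewrite yE]; apply: next_on.
  have [exS _] := xS; have [gS _] := cycP S exS.
  move: yE; rewrite xE -ST => /(can_inj (prev_next (graph_cycle_uniq gS))).
  by [].
case: (rhoP x) => [[Nx mx]|[S xS ->]].
  split; first by case: mx.
  by apply/negP => rc; have [[]] := matched_sym Nx mx; exists c.
have [exS xS'] := xS; have [gS _] := cycP S exS.
split; first exact: graph_cycle_adj.
apply: contra xc => nc; rewrite (cycles_meet_eq gc gS nc) //.
by rewrite mem_next.
Qed.

End Exits.
End Graph.

(** * Perturbation of real roots *)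

Import numFieldNormedType.Exports.

Section RootPerturbation.
Local Open Scope ring_scope.
Variable R : realType.
Implicit Types (p q : {poly R}) (s : seq R) (d e M r : R).

(** A smaller bound is again admissible, so the minimum of finitely many bounds serves for all. *)
Lemma uniform_pos (T : eqType) (s : seq T) (Q : T -> R -> Prop) :
    (forall x d e, d <= e -> Q x e -> Q x d) ->
    (forall x, x \in s -> exists2 e, 0 < e & Q x e) ->
  exists2 e, 0 < e & forall x, x \in s -> Q x e.
Proof.
move=> Qanti; elim: s => [|a s IHs] Qs; first by exists 1.
have [|e e0 Qe] := IHs; first by move=> x xs; apply: Qs; rewrite inE xs orbT.
have [|d d0 Qd] := Qs a; first by rewrite inE eqxx.
exists (Num.min d e); first by rewrite lt_min d0.
move=> x; rewrite inE => /predU1P[->|xs].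
  by apply: Qanti Qd; rewrite ge_min lexx.
by apply: Qanti (Qe x xs); rewrite ge_min lexx orbT.
Qed.

Lemma separation s :
  exists2 d, 0 < d & forall a b, a \in s -> b \in s -> `|a - b| < 2 * d -> a = b.
Proof.
have [x d e de + h|[a b] _|d d0 Hd] := @uniform_pos _ [seq (a, b) | a <- s, b <- s]
  (fun u e => `|u.1 - u.2| < 2 * e -> u.1 = u.2).
- by apply; apply: lt_le_trans h _; rewrite ler_pM2l.
- have [->|ab] := eqVneq a b; first by exists 1.
  exists (`|a - b| / 2); first by rewrite divr_gt0 // normr_gt0 subr_eq0.
  by rewrite /= mulrC divfK ?pnatr_eq0 // ltxx.
exists d => // a b sa sb; apply: (Hd (a, b)).
by apply/allpairsP; exists (a, b).
Qed.

Definition coef_close e p q := forall i, `|p`_i - q`_i| <= e.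

Lemma coef_closeW d e p q : d <= e -> coef_close d p q -> coef_close e p q.
Proof. by move=> de pq i; apply: le_trans de. Qed.

Lemma coef_close_deriv e p q n : (size p <= n)%N -> (size q <= n)%N ->
  0 <= e -> coef_close e p q -> coef_close (e *+ n) p^`() q^`().
Proof.
move=> pn qn e0 pq i; rewrite !coef_deriv -mulrnBl normrMn.
have [ni|ni] := ltnP i n.
  by apply: le_trans (ler_wMn2r _ (pq _)) _; apply: ler_wpMn2l.
rewrite !nth_default ?(leq_trans pn) ?(leq_trans qn) ?(leq_trans ni) //.
by rewrite subrr normr0 mul0rn mulrn_wge0.
Qed.

Lemma coef_close_horner e p q n M (x : R) : (size p <= n)%N -> (size q <= n)%N ->
  coef_close e p q -> `|x| <= M ->
  `|p.[x] - q.[x]| <= e * \sum_(i < n) M ^+ i.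
Proof.
move=> pn qn pq xM; rewrite (horner_coef_wide _ pn) (horner_coef_wide _ qn).
rewrite -sumrB (le_trans (ler_norm_sum _ _ _)) // mulr_sumr ler_sum // => i _.
rewrite -mulrBl normrM normrX; apply: ler_pM => //.
  exact: exprn_ge0.
by rewrite lerXn2r ?nnegrE // (le_trans _ xM).
Qed.

Lemma coef_close_horner_lt q n M d : (size q <= n)%N -> 0 <= M -> 0 < d ->
  exists2 e, 0 < e & forall p, (size p <= n)%N -> coef_close e p q ->
    forall x, `|x| <= M -> `|p.[x] - q.[x]| < d.
Proof.
move=> qn M0 d0; pose S := \sum_(i < n) M ^+ i.
have S0 : 0 <= S by apply: sumr_ge0 => i _; apply: exprn_ge0.
exists (d / (S + 1)) => [|p pn pq x xM]; first by rewrite divr_gt0 // ltr_wpDl.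
apply: le_lt_trans (coef_close_horner pn qn pq xM) _.
by rewrite mulrAC ltr_pdivrMr ?ltr_wpDl // ltr_pM2l // ltrDl.
Qed.

Lemma coef_close_deriv_lt q n M d : (size q <= n)%N -> 0 <= M -> 0 < d ->
  exists2 e, 0 < e & forall p, (size p <= n)%N -> coef_close e p q ->
    forall x, `|x| <= M -> `|p^`().[x] - q^`().[x]| < d.
Proof.
move=> qn M0 d0.
have szd (r : {poly R}) : (size r <= n)%N -> (size r^`() <= n)%N.
  move=> rn; have [->|r0] := eqVneq r 0; first by rewrite deriv0 size_poly0.
  by rewrite ltnW // (leq_trans (lt_size_deriv r0)).
have [e e0 He] := coef_close_horner_lt (szd _ qn) M0 d0.
exists (e / n.+1%:R) => [|p pn pq]; first by rewrite divr_gt0.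
apply: He; first exact: szd.
have := coef_close_deriv pn qn _ pq; rewrite divr_ge0 ?ltW // => /(_ isT).
apply: coef_closeW.
by rewrite -[leLHS]mulr_natr mulrAC ler_pdivrMr // ler_pM2l // ler_nat.
Qed.

(** Being closer to [w] than [0] is, [u] has the sign of [w]. *)
Lemma mul_gt0_close (u w : R) : `|u - w| < `|w| -> 0 < u * w.
Proof.
case: (ltrgtP w 0) => [w0|w0|->]; last by rewrite normr0 ltNge normr_ge0.
  rewrite (ltr0_norm w0) ltr_norml => /andP[? ?].
  by rewrite nmulr_lgt0 //; lra.
rewrite (gtr0_norm w0) ltr_norml => /andP[? ?].
by rewrite pmulr_lgt0 //; lra.
Qed.

(** Writing [q] as [g] times ['X - r], with [g.[r]] equal to the derivative at [r], shows that [q]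
    changes sign between [r - c] and [r + c]. A close [p] has the same signs there, and the
    intermediate value theorem applies. *)
Lemma simple_root_persists q r d : 0 < d -> root q r -> q^`().[r] != 0 ->
  exists2 e, 0 < e & forall p, (size p <= size q)%N -> coef_close e p q ->
    exists2 y, `|y - r| < d & root p y.
Proof.
move=> d0 /factor_theorem[g qE]; rewrite {1}qE derivM derivXsubC mulr1.
rewrite !hornerE subrr mulr0 add0r => g0.
have [|d1 d10 Hg] := @poly_cont R r g `|g.[r]|; first by rewrite normr_gt0.
pose c := Num.min d d1 / 2.
have m0 : 0 < Num.min d d1 by rewrite lt_min d0.
have c0 : 0 < c by rewrite divr_gt0.
have cm : c < Num.min d d1 by rewrite /c; lra.
clearbody c; have [cd cd1] : c < d /\ c < d1 by move: cm; rewrite lt_min => /andP.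
have qa : q.[r - c] = - c * g.[r - c] by rewrite qE !hornerE; ring.
have qb : q.[r + c] = c * g.[r + c] by rewrite qE !hornerE; ring.
have ga : `|g.[r - c] - g.[r]| < `|g.[r]|.
  by apply: Hg; rewrite addrAC subrr add0r normrN gtr0_norm.
have gb : `|g.[r + c] - g.[r]| < `|g.[r]|.
  by apply: Hg; rewrite addrAC subrr add0r gtr0_norm.
have gg : 0 < g.[r - c] * g.[r + c].
  have gg2 : 0 < g.[r] * g.[r] by rewrite -expr2 exprn_even_gt0.
  rewrite -(pmulr_lgt0 _ gg2) mulrACA.
  exact: mulr_gt0 (mul_gt0_close ga) (mul_gt0_close gb).
have [ga0 gb0] : g.[r - c] != 0 /\ g.[r + c] != 0.
  by split; apply: contraTneq gg => ->; rewrite ?mul0r ?mulr0 ltxx.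
pose M := `|r| + c.
have M0 : 0 <= M by rewrite addr_ge0 // ltW.
(* A change by less than [t] preserves both signs. *)
pose t := Num.min `|q.[r - c]| `|q.[r + c]|.
have t0 : 0 < t.
  have cn0 : c != 0 by rewrite gt_eqF.
  by rewrite lt_min !normr_gt0 qa qb !mulNr oppr_eq0 (mulf_neq0 cn0 ga0) (mulf_neq0 cn0 gb0).
have [e e0 He] := coef_close_horner_lt (leqnn (size q)) M0 t0.
exists e => // p pq epq.
have c_r : `|r - c| <= M by rewrite (le_trans (ler_normB _ _)) // (gtr0_norm c0).
have cr : `|r + c| <= M by rewrite (le_trans (ler_normD _ _)) // (gtr0_norm c0).
have /= := He p pq epq _ c_r; rewrite lt_min => /andP[pa _].
have /= := He p pq epq _ cr; rewrite lt_min => /andP[_ pb].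
have qq : q.[r - c] * q.[r + c] < 0.
  rewrite qa qb; have -> : - c * g.[r - c] * (c * g.[r + c]) = - (c * c * (g.[r - c] * g.[r + c])) by ring.
  by rewrite oppr_lt0; exact: mulr_gt0 (mulr_gt0 c0 c0) gg.
have pp : p.[r - c] * p.[r + c] < 0.
  have h := mulr_gt0 (mul_gt0_close pa) (mul_gt0_close pb).
  by rewrite mulrACA nmulr_lgt0 in h.
have [|y] := poly_ivtoo _ pp; first by lra.
rewrite in_itv /= => /andP[y1 y2] py; exists y => //.
by rewrite ltr_norml; apply/andP; split; lra.
Qed.

Lemma rootsR_mem p x : p != 0 -> (x \in rootsR p) = root p x.
Proof. by move=> p0; rewrite -roots_on_rootsR // in_itv. Qed.

Lemma uniq_rootsR p : uniq (rootsR p).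
Proof. exact: uniq_roots. Qed.

Definition num_real_roots p := (\sum_(a <- rootsR p) mup a p)%N.

Lemma size_rootsR_le_num p : (size (rootsR p) <= num_real_roots p)%N.
Proof.
have [->|p0] := eqVneq p 0; first by rewrite rootsR0.
rewrite -sum1_size /num_real_roots big_seq [leqRHS]big_seq leq_sum // => a.
by rewrite rootsR_mem // -dvdp_XsubCl XsubC_dvd.
Qed.

Lemma mup_simple p a : p^`().[a] != 0 -> (mup a p <= 1)%N.
Proof.
move=> pa; have p0 : p != 0 by apply: contraNneq pa => ->; rewrite deriv0 horner0.
rewrite leqNgt mup_geq //; apply: contra pa => /dvdpP[g ->].
by rewrite expr2 !derivM derivXsubC !(hornerXsubC, hornerD, hornerM) subrr !(mulr0, mul0r, addr0).
Qed.

Lemma num_simple_roots p :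
  (forall a, root p a -> p^`().[a] != 0) -> (num_real_roots p <= size (rootsR p))%N.
Proof.
move=> sp; have [->|p0] := eqVneq p 0; first by rewrite /num_real_roots rootsR0 big_nil.
rewrite -sum1_size /num_real_roots big_seq [leqRHS]big_seq leq_sum // => a.
by rewrite rootsR_mem // => /sp/mup_simple.
Qed.

(** Each [r] in [s] has a root of [p] within [d], and [d] is so small that these roots differ for
    different [r]. *)
Lemma num_real_roots_lower q s : uniq s ->
    (forall r, r \in s -> root q r /\ q^`().[r] != 0) ->
  exists2 e, 0 < e & forall p, p != 0 -> (size p <= size q)%N -> coef_close e p q ->
    (size s <= num_real_roots p)%N.
Proof.
move=> us hs; have [d d0 sep] := separation s.
have [r e e' ee' H p pq pe|r rs|e e0 He] := @uniform_pos _ s (fun r e =>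
  forall p, (size p <= size q)%N -> coef_close e p q ->
    exists2 y, `|y - r| < d & root p y).
- by apply: H => //; apply: coef_closeW ee' pe.
- by have [rq rq'] := hs r rs; apply: simple_root_persists.
exists e => // p p0 pq pe; apply: leq_trans (size_rootsR_le_num p).
pose near r y := `|y - r| < d.
pose f r := nth 0 (rootsR p) (find (near r) (rootsR p)).
have fP r : r \in s -> (f r \in rootsR p) /\ near r (f r).
  move=> rs; have [y yr py] := He r rs p pq pe.
  have h : has (near r) (rootsR p) by apply/hasP; exists y => //; rewrite rootsR_mem.
  by split; [rewrite mem_nth // -has_find | exact: nth_find].
rewrite -(size_map f); apply: uniq_leq_size.
  rewrite map_inj_in_uniq // => a b sa sb fab; apply: sep => //.
  have [_] := fP a sa; have [_] := fP b sb; rewrite /near fab => h1 h2.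
  have -> : a - b = (f b - b) - (f b - a) by ring.
  apply: le_lt_trans (ler_normB _ _) _; lra.
by move=> _ /mapP[r rs ->]; case: (fP r rs).
Qed.

(** Far from the roots of [q], a close [p] has no root, since [q] is bounded away from [0] there.
    Near a root of [q] the derivative of [p] does not vanish, so by Rolle [p] has at most one root
    there, and it is simple. Being monic keeps all roots of [p] in a fixed interval. *)
Lemma num_real_roots_upper q : q \is monic ->
    (forall r, root q r -> q^`().[r] != 0) ->
  exists2 e, 0 < e & forall p, p \is monic -> size p = size q -> coef_close e p q ->
    (num_real_roots p <= size (rootsR q))%N.
Proof.
move=> mq sq; have q0 := monic_neq0 mq.
pose s := rootsR q.
have sP r : (r \in s) = root q r by rewrite rootsR_mem.
have [z c e ce [m m0 h]|r rs|d d0 Hd] := @uniform_pos _ s (fun r d =>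
    exists2 m, 0 < m & forall x, `|x - r| < d -> m <= `|q^`().[x]|).
- by exists m => // x xr; apply: h; apply: lt_le_trans xr ce.
- have q'r : q^`().[r] != 0 by rewrite sq -?sP.
  have [|c c0 Hc] := @poly_cont R r q^`() (`|q^`().[r]| / 2).
    by rewrite divr_gt0 // normr_gt0.
  exists c => //; exists (`|q^`().[r]| / 2); first by rewrite divr_gt0 // normr_gt0.
  move=> x /Hc h; have := ler_distD q^`().[x] 0 q^`().[r].
  by rewrite !sub0r !normrN => h2; lra.
have [r e e' ee' H x xr|r rs|m m0 Hm] := @uniform_pos _ s (fun r m =>
    forall x, `|x - r| < d -> m <= `|q^`().[x]|).
- by apply: le_trans ee' (H x xr).
- by have [m m0 mP] := Hd r rs; exists m.
(* [M] dominates the Cauchy bound of every monic [p] of this size whose coefficients are within [1]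
   of those of [q]. *)
pose M := 1 + \sum_(i < size q) (`|q`_i| + 1).
have M0 : 0 <= M by rewrite addr_ge0 // sumr_ge0 // => i _; rewrite addr_ge0.
(* The tents of radius [d] make [h] positive also at the roots of [q]. Outside the tents [h] is the
   absolute value of [q], so the minimum of [h] on the interval bounds [q] there. *)
pose h (x : R) := `|q.[x]| + \sum_(r <- s) Num.max 0 (d - `|x - r|).
have sumc (s' : seq R) : continuous (fun x => \sum_(r <- s') Num.max 0 (d - `|x - r|)).
  elim: s' => [|r s' IHs] x.
    by under eq_fun do rewrite big_nil; exact: cvg_cst.
  under eq_fun do rewrite big_cons; apply: cvgD; last exact: IHs.
  apply: (@continuous_max R R (fun=> 0) (fun x => d - `|x - r|)); first exact: cvg_cst.
  apply: cvgB; first exact: cvg_cst.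
  by apply: cvg_norm; apply: cvgB; [exact: cvg_id|exact: cvg_cst].
have hcont : continuous h.
  move=> x; apply: cvgD; last exact: sumc.
  by apply: cvg_norm; exact: continuous_horner.
have [|c _ hmin] := @EVT_min R h (- M) M _ (continuous_subspaceT hcont).
  by rewrite ge0_cp.
have sumge0 x : 0 <= \sum_(r <- s) Num.max 0 (d - `|x - r|).
  by apply: sumr_ge0 => r _; rewrite le_max lexx.
have hc : 0 < h c.
  have [qc|qc] := eqVneq q.[c] 0; last by rewrite ltr_pwDl // normr_gt0.
  rewrite ltr_wpDl //; have cs : c \in s by rewrite sP; apply/rootP.
  rewrite (big_rem c) //= subrr normr0 subr0 ltr_pwDl //.
    by rewrite lt_max d0 orbT.
  by apply: sumr_ge0 => r _; rewrite le_max lexx.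
have [e1 e10 He1] := coef_close_horner_lt (leqnn (size q)) M0 hc.
have [e2 e20 He2] := coef_close_deriv_lt (leqnn (size q)) M0 m0.
pose e := Num.min 1 (Num.min e1 e2).
exists e => [|p mp spq pe]; first by rewrite !lt_min ltr01 e10 e20.
have p0 := monic_neq0 mp.
have [e_1 e_e1 e_e2] : [/\ e <= 1, e <= e1 & e <= e2].
  by rewrite /e !ge_min !lexx ?orbT.
have pM x : root p x -> `|x| <= M.
  move=> /rootP /(cauchy_boundP p0) /ltW /le_trans; apply.
  rewrite /cauchy_bound (monicP mp) normr1 invr1 mul1r lerD2l spq ler_sum // => i _.
  have := ler_distD q`_i p`_i 0; rewrite !subr0 => h1.
  by apply: le_trans h1 _; rewrite addrC lerD2l (le_trans (pe i)).
have nearP x : root p x -> has (fun r => `|x - r| < d) s.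
  move=> px; apply: contraT => /hasPn far.
  have xM := pM x px.
  have := hmin x; rewrite in_itv /= -ler_norml => /(_ xM); rewrite leNgt => /negP[].
  rewrite /h big1_seq ?addr0 => [|r /= rs]; last first.
    by apply/max_idPl; rewrite subr_le0 leNgt far.
  have := He1 p _ (coef_closeW e_e1 pe) x xM; rewrite spq => /(_ (leqnn _)).
  by rewrite (rootP px) sub0r normrN.
have p'N0 x r : r \in s -> `|x| <= M -> `|x - r| < d -> p^`().[x] != 0.
  move=> rs xM xr; have := He2 p _ (coef_closeW e_e2 pe) x xM.
  rewrite spq => /(_ (leqnn _)) h1; apply: contraTneq h1 => ->.
  by rewrite sub0r normrN -leNgt (Hm r).
have p_simple x : root p x -> p^`().[x] != 0.
  by move=> px; have /hasP[r rs xr] := nearP x px; apply: p'N0 xr; rewrite ?pM.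
apply: leq_trans (num_simple_roots p_simple) _.
pose f x := nth 0 s (find (fun r => `|x - r| < d) s).
have fP x : root p x -> (f x \in s) /\ `|x - f x| < d.
  move=> /nearP h1; split; first by rewrite mem_nth // -has_find.
  exact: (nth_find 0 h1).
have f_inj a b : root p a -> root p b -> a < b -> f a <> f b.
  move=> pa pb ab fab; have [fas da] := fP a pa; have [_] := fP b pb.
  rewrite -fab => db; have [z] := poly_rolle ab (etrans (rootP pa) (esym (rootP pb))).
  rewrite in_itv /= => /andP[az zb]; apply/eqP; apply: (p'N0 _ (f a)) => //.
    have := pM a pa; have := pM b pb; rewrite !ler_norml => /andP[? ?] /andP[? ?].
    by apply/andP; split; lra.
  move: da db; rewrite !ltr_norml => /andP[? ?] /andP[? ?].
  by apply/andP; split; lra.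
rewrite -(size_map f); apply: uniq_leq_size => [|z /mapP[x]]; last first.
  by rewrite rootsR_mem // => /fP[h1 _] ->.
rewrite map_inj_in_uniq ?uniq_rootsR // => a b.
rewrite !rootsR_mem // => pa pb fab; case: (ltrgtP a b) => // ab.
  by case: (f_inj a b).
by case: (f_inj b a).
Qed.
End RootPerturbation.

(** * Weighted permutation matrices *)

Import GroupScope.

Section PermutationMatrices.
Local Open Scope ring_scope.

Section PermutationDeterminant.
Variables (K : comNzRingType) (n : nat) (s : 'S_n) (x : K) (w : 'I_n -> K).
Implicit Types (S T O : {set 'I_n}) (i j : 'I_n).

(* Rows outside [S] are those of the identity, so that block diagonal
   matrices factor as products of such matrices. *)
Definition block_mx_on S : 'M[K]_n :=
  \matrix_(i, j) if i \in S then x *+ (i == j) - w i *+ (j == s i) else (i == j)%:R.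

(** In the rows of [S], the first factor is supported on columns in [S], as [s] preserves [S]; the
    second factor is the identity on the rows of [S]. *)
Lemma block_mx_onU S T : [disjoint S & T] -> (forall i, i \in S -> s i \in S) ->
  block_mx_on (S :|: T) = block_mx_on S *m block_mx_on T.
Proof.
move=> dST Ss; apply/matrixP => i j; rewrite !mxE.
have [iS|iS] := boolP (i \in S); last first.
  rewrite (bigD1 i) //= !mxE (negPf iS) eqxx mul1r inE (negPf iS) /=.
  rewrite big1 ?addr0 // => k ki; rewrite !mxE (negPf iS) eq_sym (negPf ki).
  by rewrite mul0r.
rewrite inE iS /= (bigD1 j) //= big1 => [|k kj]; rewrite !mxE iS.
  have [jT|jT] := boolP (j \in T); last by rewrite eqxx mulr1 addr0.
  have jS : j \notin S by rewrite disjoint_sym in dST; rewrite (disjointFr dST).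
  rewrite (_ : (i == j) = false); last by apply: contraNF jS => /eqP <-.
  rewrite (_ : (j == s i) = false); last by apply: contraNF jS => /eqP ->; exact: Ss.
  by rewrite subrr mul0r addr0.
have [kT|kT] := boolP (k \in T); last by rewrite (negPf kj) mulr0.
have kS : k \notin S by rewrite disjoint_sym in dST; rewrite (disjointFr dST).
rewrite (_ : (i == k) = false); last by apply: contraNF kS => /eqP <-.
rewrite (_ : (k == s i) = false); last by apply: contraNF kS => /eqP ->; exact: Ss.
by rewrite subrr mul0r.
Qed.

Lemma porbit_stable O i : O \in porbits s -> (s i \in O) = (i \in O).
Proof.
move=> /imsetP[y _ ->]; rewrite -!eq_porbit_mem.
by have := porbit_perm s 1 i; rewrite expg1 => ->.
Qed.

Section OneOrbit.
Variable O : {set 'I_n}.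
Hypothesis O_orbit : O \in porbits s.

Definition orbit_fun i := if i \in O then s i else i.

Lemma orbit_fun_inj : injective orbit_fun.
Proof.
move=> i j; rewrite /orbit_fun; case: ifPn => iO; case: ifPn => jO ij //.
- exact: perm_inj ij.
- by rewrite -ij porbit_stable // iO in jO.
- by rewrite ij porbit_stable // jO in iO.
Qed.

Definition orbit_perm := perm orbit_fun_inj.

Lemma orbit_permE i : orbit_perm i = if i \in O then s i else i.
Proof. exact: permE. Qed.

Lemma orbit_permX i k : i \in O -> (orbit_perm ^+ k)%g i = (s ^+ k)%g i.
Proof.
move=> iO; elim: k => [|k IHk]; first by rewrite !expg0.
rewrite !expgSr !permM IHk orbit_permE; case: ifPn => //.
by case/imsetP: O_orbit iO => y _ ->; rewrite -!eq_porbit_mem => /eqP <-; rewrite porbit_perm eqxx.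
Qed.

Lemma porbit_in i : i \in O -> porbit s i = O.
Proof. by case/imsetP: O_orbit => y _ ->; rewrite -eq_porbit_mem => /eqP. Qed.

Lemma porbits_orbit_perm : porbits orbit_perm = O |: [set [set i] | i in ~: O].
Proof.
have inO i : i \in O -> porbit orbit_perm i = O.
  move=> iO; apply/setP => j; rewrite -[in RHS](porbit_in iO).
  by apply/porbitP/porbitP => -[k ->]; exists k; rewrite orbit_permX.
have offO i : i \notin O -> porbit orbit_perm i = [set i].
  move=> iO; apply/setP => j; rewrite inE; apply/porbitP/eqP => [[k ->]|->].
    by rewrite permX; elim: k => //= k ->; rewrite orbit_permE (negPf iO).
  by exists 0; rewrite expg0 perm1.
apply/setP => A; apply/imsetP/idP => [[i _ ->]|].
  have [iO|iO] := boolP (i \in O); first by rewrite inO // setU11.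
  by rewrite offO // setU1r // imset_f // inE.
case/setU1P => [->|/imsetP[i]].
  by have /imsetP[y _ Oy] := O_orbit; exists y => //; rewrite inO // Oy porbit_id.
by rewrite inE => iO ->; exists i => //; rewrite offO.
Qed.

(** A cycle of length [m] has the sign of [m - 1], here read off from the number of orbits. *)
Lemma orbit_perm_sign : (-1) ^+ orbit_perm * (-1) ^+ #|O| = -1 :> K.
Proof.
have [y yO] : exists y, y \in O.
  by have /imsetP[y _ ->] := O_orbit; exists y; rewrite porbit_id.
have cO : (#|O| + #|~: O| = n)%N by rewrite cardsC card_ord.
have oddE : odd_perm orbit_perm = odd n (+) odd #|porbits orbit_perm|.
  by rewrite /odd_perm card_ord.
rewrite oddE porbits_orbit_perm cardsU1 card_imset; last exact: set1_inj.
have -> : O \notin [set [set i] | i in ~: O].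
  apply/imsetP => -[i]; rewrite inE => iO Oi.
  by rewrite Oi set11 in iO.
rewrite -[(-1) ^+ #|O|]signr_odd -signr_addb -[in odd n]cO !oddD /=.
by case: (odd #|O|); case: (odd #|~: O|); rewrite ?expr1.
Qed.

(** For a fixed point the matrix is diagonal. Otherwise only the identity and the cycle [orbit_perm]
    contribute to the Leibniz expansion. *)
Lemma det_block_orbit :
  \det (block_mx_on O) = x ^+ #|O| - \prod_(i in O) w i.
Proof.
have [y yO] : exists y, y \in O.
  by have /imsetP[y _ ->] := O_orbit; exists y; rewrite porbit_id.
have [sy|sy] := eqVneq (s y) y.
  have O1 : O = [set y].
    apply/setP => j; rewrite -(porbit_in yO) inE; apply/porbitP/eqP => [[k ->]|->].
      by rewrite permX; elim: k => //= k ->.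
    by exists 0; rewrite expg0 perm1.
  have -> : block_mx_on O = diag_mx (\row_i if i == y then x - w y else 1).
    apply/matrixP => i j; rewrite !mxE O1 inE; case: eqVneq => [->|_].
      by rewrite sy [j == y]eq_sym; case: eqVneq; rewrite ?subrr.
    by [].
  rewrite det_diag (bigD1 y) //= mxE eqxx big1 => [|i iy]; last by rewrite mxE (negPf iy).
  by rewrite O1 cards1 big_set1 mulr1 expr1.
have sN i : i \in O -> s i != i.
  move=> iO; apply: contraNneq sy => si.
  have : y \in porbit s i by rewrite (porbit_in iO).
  move=> /porbitP[k ->]; suff -> : (s ^+ k)%g i = i by rewrite si.
  by rewrite permX; elim: k => //= k ->.
rewrite /determinant (bigD1 1%g) //= (bigD1 orbit_perm) /=; last first.
  by apply/eqP => /permP/(_ y); rewrite orbit_permE yO perm1; apply/eqP.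
rewrite [X in _ + (_ + X)]big1 ?addr0; last first.
  move=> t /andP[t1 tO].
  suff [i ti] : exists i, block_mx_on O i (t i) = 0.
    by rewrite (bigD1 i) //= ti mul0r mulr0.
  (* The columns where row [i] can have a nonzero entry. *)
  pose good i := if i \in O then (t i == i) || (t i == s i) else t i == i.
  have [i Ni|all_good] := pickP (fun i => ~~ good i).
    exists i; rewrite mxE; move: Ni; rewrite /good; case: ifP => _.
      by rewrite negb_or eq_sym => /andP[/negPf-> /negPf->]; rewrite subrr.
    by rewrite eq_sym => /negPf->.
  have {}all_good i : good i by have := all_good i; case: (good i).
  have [i /andP[iO /eqP ti]|noshift] := pickP (fun i => (i \in O) && (t i == s i)).
    case/eqP: tO; apply/permP => j; rewrite orbit_permE.
    have [|jO] := boolP (j \in O); last first.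
      by have := all_good j; rewrite /good (negPf jO) => /eqP.
    rewrite -(porbit_in iO) => /porbitP[k ->].
    elim: k => [|k IHk]; first by rewrite expg0 perm1.
    have skO m : (s ^+ m)%g i \in O by rewrite -(porbit_in iO) mem_porbit.
    (* Fixing this point is impossible: [t] already sends its predecessor on the orbit to it. So [t]
       agrees with [s] on all of [O] once it does at one point. *)
    have := all_good ((s ^+ k.+1)%g i); rewrite /good skO => /orP[|/eqP//].
    rewrite {2}expgSr permM -IHk (inj_eq perm_inj) expgSr permM.
    by rewrite (negPf (sN _ (skO k))).
  case/eqP: t1; apply/permP => i; rewrite perm1; apply/eqP.
  have := all_good i; have := noshift i; rewrite /good.
  by case: (i \in O) => //= ->; rewrite orbF.
rewrite odd_perm1 expr0 mul1r; congr (_ + _).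
  rewrite (bigID (mem O)) /= [X in _ * X]big1 => [|i iO]; last first.
    by rewrite mxE perm1 (negPf iO) eqxx.
  rewrite mulr1 (eq_bigr (fun=> x)) => [|i iO]; first by rewrite prodr_const.
  by rewrite mxE perm1 iO eqxx eq_sym (negPf (sN i iO)) subr0.
rewrite (bigID (mem O)) /= [X in _ * (_ * X)]big1 => [|i iO]; last first.
  by rewrite mxE orbit_permE (negPf iO) eqxx.
rewrite mulr1 (eq_bigr (fun i => - w i)) => [|i iO]; last first.
  by rewrite mxE orbit_permE iO eqxx eq_sym (negPf (sN i iO)) sub0r.
by rewrite prodrN mulrA orbit_perm_sign mulN1r.
Qed.

End OneOrbit.

Lemma block_mx_on0 : block_mx_on set0 = 1%:M.
Proof. by apply/matrixP => i j; rewrite !mxE inE. Qed.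

Lemma det_perm_mx_sub :
  \det (\matrix_(i, j) (x *+ (i == j) - w i *+ (j == s i))) =
  \prod_(O in porbits s) (x ^+ #|O| - \prod_(i in O) w i).
Proof.
have -> : \matrix_(i, j) (x *+ (i == j) - w i *+ (j == s i)) = block_mx_on [set: 'I_n].
  by apply/matrixP => i j; rewrite !mxE inE.
have dist (r : seq {set 'I_n}) : uniq r -> {subset r <= porbits s} ->
    \det (block_mx_on (\bigcup_(O <- r) O)) =
    \prod_(O <- r) (x ^+ #|O| - \prod_(i in O) w i).
  elim: r => [|O r IHr] /=; first by rewrite !big_nil block_mx_on0 det1.
  move=> /andP[Or ur] sub; have Oo := sub O (mem_head _ _).
  rewrite !big_cons block_mx_onU; last by move=> i iO; rewrite porbit_stable.
    rewrite det_mulmx det_block_orbit // IHr // => A Ar.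
    by apply: sub; rewrite inE Ar orbT.
  rewrite -setI_eq0; apply/eqP/setP => i; rewrite !inE; apply/negP => /andP[iO].
  rewrite bigcup_seq => /bigcupP[A Ar iA]; case/negP: Or.
  rewrite -(porbit_in Oo iO) (porbit_in _ iA) //.
  by apply: sub; rewrite inE Ar orbT.
rewrite -[RHS]big_enum -dist ?enum_uniq // => [|O]; last by rewrite mem_enum.
congr (\det (block_mx_on _)); apply/esym/setP => i; rewrite inE big_enum.
by apply/bigcupP; exists (porbit s i); rewrite ?imset_f ?porbit_id.
Qed.

End PermutationDeterminant.

Lemma char_poly_perm (K : comNzRingType) n (s : 'S_n) (w : 'I_n -> K) :
  char_poly (\matrix_(i, j) (w i *+ (j == s i))) =
  \prod_(O in porbits s) ('X^#|O| - (\prod_(i in O) w i)%:P).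
Proof.
transitivity (\prod_(O in porbits s) ('X^#|O| - \prod_(i in O) (w i)%:P)).
  rewrite -det_perm_mx_sub; congr (\det _); apply/matrixP => i j.
  by rewrite !mxE polyCMn.
by apply: eq_bigr => O _; rewrite rmorph_prod.
Qed.

(** * From the closure of the qualitative class to the class itself *)

Section Perturbation.
Variables (R : realType) (n : nat).
Implicit Types (A B : 'M[R]_n) (P : 'M[sign]_n).

(** The coefficients are polynomials in [t], namely those of the characteristic polynomial [F] over
    the polynomial ring, hence continuous at [0]. *)
Lemma char_poly_perturb A B (d : R) : 0 < d ->
  exists2 e, 0 < e & forall t, `|t| < e -> coef_close d (char_poly (A + t *: B)) (char_poly A).
Proof.
move=> d0; pose F := char_poly (map_mx polyC A + 'X *: map_mx polyC B).
have FE t : char_poly (A + t *: B) = map_poly (horner_eval t) F.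
  rewrite map_char_poly; congr char_poly; apply/matrixP => i j.
  by rewrite !mxE /= /horner_eval hornerD hornerM hornerX !hornerC.
have FC t i : (char_poly (A + t *: B))`_i = (F`_i).[t].
  by rewrite FE coef_map.
have [i e e' ee' H t te|i _|e e0 He] := @uniform_pos R nat (iota 0 n.+1) (fun i e =>
  forall t, `|t| < e -> `|(F`_i).[t] - (F`_i).[0]| < d).
- by apply: H; apply: lt_le_trans te ee'.
- have [e e0 He] := @poly_cont R 0 (F`_i) d d0.
  by exists e => // t te; apply: He; rewrite subr0.
exists e => // t te i; have [ni|ni] := ltnP i n.+1.
  rewrite FC [X in `|_ - X|](_ : _ = (F`_i).[0]); last by rewrite -FC scale0r addr0.
  rewrite ltW // He //.
  by rewrite mem_iota.
by rewrite !nth_default ?size_char_poly // subrr normr0 ltW.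
Qed.

Definition in_closure P A := forall i j, A i j = 0 \/ sgz (A i j) = P i j.

(** A small positive multiple of the sign matrix [B] is added: zero entries acquire the prescribed
    sign and the others keep it. *)
Lemma in_closure_approx P A (d : R) : in_closure P A -> 0 < d ->
  exists2 A', qualitative_class P A' & coef_close d (char_poly A') (char_poly A).
Proof.
move=> clA d0; pose B : 'M[R]_n := \matrix_(i, j) (P i j : int)%:~R.
have [e e0 He] := char_poly_perturb A B d0.
have e2 : 0 < e / 2 by rewrite divr_gt0.
exists (A + (e / 2) *: B); last by apply: He; rewrite gtr0_norm //; lra.
move=> i j; rewrite !mxE; have := clA i j.
case: (P i j) => /=; rewrite ?mulr1 ?mulrN1 ?mulr0 ?addr0.
- case=> [->|/eqP]; first by rewrite add0r gtr0_sgz.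
  by rewrite sgz_cp0 => ?; rewrite gtr0_sgz // addr_gt0.
- case=> [->|/eqP]; first by rewrite add0r sgzN gtr0_sgz.
  by rewrite sgz_cp0 => ?; rewrite ltr0_sgz // subr_lt0 (lt_trans _ e2).
- by case=> [->|//]; rewrite sgz0.
Qed.

Variables (P : 'M[sign]_n) (k : nat).
Hypothesis P_consistent : forall A, qualitative_class P A -> num_real_eigenvalues A = k.

Lemma consistent_lower A (s : seq R) : in_closure P A -> uniq s ->
    (forall r, r \in s -> root (char_poly A) r /\ (char_poly A)^`().[r] != 0) ->
  (size s <= k)%N.
Proof.
move=> clA us sP; have [e e0 He] := num_real_roots_lower us sP.
have [A' QA' closeA'] := in_closure_approx clA e0.
rewrite -(P_consistent QA'); apply: He closeA'; rewrite ?size_char_poly //.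
exact: monic_neq0 (char_poly_monic _).
Qed.

Lemma consistent_upper A : in_closure P A ->
    (forall r, root (char_poly A) r -> (char_poly A)^`().[r] != 0) ->
  (k <= size (rootsR (char_poly A)))%N.
Proof.
move=> clA sA; have [e e0 He] := num_real_roots_upper (char_poly_monic A) sA.
have [A' QA' closeA'] := in_closure_approx clA e0.
rewrite -(P_consistent QA'); apply: He closeA'; rewrite ?size_char_poly //.
exact: char_poly_monic.
Qed.

End Perturbation.

End PermutationMatrices.

(** * Real eigenvalues of the matrix of a permutation *)

Section OrbitMatrix.
Local Open Scope ring_scope.
Variables (R : realType) (n : nat) (P : 'M[sign]_n).
Implicit Types (s : 'S_n) (O C : {set 'I_n}) (i j : 'I_n) (r : R).

(* Distinct blocks get distinct spectral radii. *)
Definition radius O : R := (enum_rank O).+1%:R.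

Lemma radius_gt0 O : 0 < radius O. Proof. by rewrite ltr0n. Qed.

Lemma radius_inj : injective radius.
Proof. by move=> O O' /eqP; rewrite eqr_nat eqSS => /eqP /val_inj /enum_rank_inj. Qed.

Definition orbit_mx s : 'M[R]_n :=
  \matrix_(i, j) ((radius (porbit s i) * (P i (s i) : int)%:~R) *+ (j == s i)).

Definition orbit_sign s O : int := \prod_(i in O) (P i (s i) : int).

Definition orbit_poly s O : {poly R} :=
  'X^#|O| - (radius O ^+ #|O| * (orbit_sign s O)%:~R)%:P.

Lemma char_poly_orbit_mx s :
  char_poly (orbit_mx s) = \prod_(O in porbits s) orbit_poly s O.
Proof.
rewrite char_poly_perm; apply: eq_bigr => O Oo; congr (_ - _%:P).
rewrite big_split /= rmorph_prod; congr (_ * _).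
rewrite (eq_bigr (fun=> radius O)) ?prodr_const // => i iO.
by rewrite (porbit_in Oo iO).
Qed.

Lemma orbit_mx_in_closure s : in_closure P (orbit_mx s).
Proof.
move=> i j; rewrite mxE; have [->|_] := eqVneq; [right|by left].
rewrite mulr1n sgzM (gtr0_sgz (radius_gt0 _)) mul1r.
by case: (P _ _) => /=; rewrite ?sgz1 ?sgzN1 ?sgz0 // mulrN1z sgzN sgz1.
Qed.

Lemma card_porbit_gt0 s O : O \in porbits s -> (0 < #|O|)%N.
Proof. by case/imsetP => y _ ->; rewrite lt0n card_porbit_neq0. Qed.

Lemma orbit_sign_abs s O : orbit_sign s O != 0 -> `|orbit_sign s O| = 1.
Proof.
rewrite /orbit_sign prodf_seq_neq0 => /allP sN0; rewrite normr_prod big_seq_cond big1 //.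
by move=> i /andP[/sN0 + iO]; rewrite iO /=; case: (P _ _).
Qed.

Lemma root_orbit_poly s O r : root (orbit_poly s O) r =
  (r ^+ #|O| == radius O ^+ #|O| * (orbit_sign s O)%:~R).
Proof. by rewrite rootE !hornerE subr_eq0. Qed.

(** A nonzero [orbit_sign] has absolute value [1]. Since radii are distinct, the factors of
    different orbits share no nonzero real root. *)
Lemma root_orbit_poly_norm s O r : (0 < #|O|)%N -> root (orbit_poly s O) r -> r != 0 ->
  `|r| = radius O.
Proof.
move=> O0; rewrite root_orbit_poly => /eqP rO r0.
have sN0 : orbit_sign s O != 0.
  by apply: contraNneq r0 => sO; move/eqP: rO; rewrite sO mulr0 expf_eq0 O0.
have := congr1 (fun z => `|z|) rO; rewrite normrX normrM normrX -intr_norm.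
rewrite (orbit_sign_abs sN0) mulr1.
by rewrite (gtr0_norm (radius_gt0 O)) => /eqP; rewrite eqrXn2 // ?(ltW (radius_gt0 O)) // => /eqP.
Qed.

Lemma root_orbit_poly_neq0 s O r : (0 < #|O|)%N -> orbit_sign s O != 0 ->
  root (orbit_poly s O) r -> r != 0.
Proof.
move=> O0 sN0; rewrite root_orbit_poly; apply: contraTneq => ->.
rewrite expr0n gtn_eqF // eq_sym mulf_neq0 ?intr_eq0 //.
by rewrite expf_neq0 // gt_eqF // radius_gt0.
Qed.

Lemma root_prod_mem (T : finType) (A : {pred T}) (F : T -> {poly R}) r :
  reflect (exists2 t, t \in A & root (F t) r) (root (\prod_(t in A) F t) r).
Proof.
by rewrite rootE horner_prod; exact: prodf_eq0.
Qed.

(** Exactly one factor vanishes at [r], and the derivative of ['X^m - a] vanishes only at [0] when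
    [m] is positive. *)
Lemma char_poly_orbit_mx_simple s r : root (char_poly (orbit_mx s)) r -> r != 0 ->
  (char_poly (orbit_mx s))^`().[r] != 0.
Proof.
rewrite char_poly_orbit_mx => /root_prod_mem[O Oo rO] r0.
have O0 := card_porbit_gt0 Oo; have nr := root_orbit_poly_norm O0 rO r0.
rewrite (bigD1 O) //= derivM hornerD !hornerM (rootP rO) mul0r addr0 mulf_neq0 //.
  rewrite /orbit_poly derivB derivXn derivC subr0 hornerMn hornerXn.
  by rewrite mulrn_eq0 negb_or -lt0n O0 expf_neq0.
rewrite horner_prod; apply/prodf_neq0 => O' /andP[Oo' OO'].
apply: contraNneq OO' => /eqP; rewrite -/(root _ r) => rO'.
apply/eqP/radius_inj; rewrite -nr.
by rewrite (root_orbit_poly_norm _ rO' r0) // (card_porbit_gt0 Oo').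
Qed.

Lemma rootsR_orbit_poly_mem s O r : (0 < #|O|)%N -> r \in rootsR (orbit_poly s O) ->
  orbit_sign s O != 0 -> r \in [:: radius O; - radius O].
Proof.
move=> O0; have [->|p0] := eqVneq (orbit_poly s O) 0; first by rewrite rootsR0.
rewrite rootsR_mem // => rO sN0.
have := root_orbit_poly_norm O0 rO (root_orbit_poly_neq0 O0 sN0 rO).
by rewrite !inE => /eqP; rewrite eqr_norml => /andP[].
Qed.

(** * Two permutations that agree off [C] *)

Section Compare.
Variables (s0 s1 : 'S_n) (C : {set 'I_n}) (L : seq {set 'I_n}) (k : nat).
Hypothesis P_consistent :
  forall A : 'M[R]_n, qualitative_class P A -> num_real_eigenvalues A = k.
Hypothesis s01 : forall i, i \notin C -> s1 i = s0 i.
Hypothesis C_orbit : C \in porbits s0.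
Hypothesis s1C : forall i, i \in C -> s1 i \in C.
Hypothesis s0N0 : forall i, (P i (s0 i) : int) != 0.
Hypothesis uL : uniq L.
Hypothesis LP : forall O, O \in L ->
  [/\ O \in porbits s1, O \subset C, #|O| = 2%N & orbit_sign s1 O = 1].

Let s0C i : (s0 i \in C) = (i \in C). Proof. exact: porbit_stable. Qed.

Let porbit_off i : i \notin C -> porbit s1 i = porbit s0 i.
Proof.
move=> iC; have off m : (s0 ^+ m)%g i \notin C.
  by elim: m => [|m IHm]; rewrite ?expg0 ?perm1 // expgSr permM s0C.
have e m : (s1 ^+ m)%g i = (s0 ^+ m)%g i.
  elim: m => [|m IHm]; first by rewrite !expg0.
  by rewrite !expgSr !permM IHm s01.
by apply/setP => j; apply/porbitP/porbitP => -[m ->]; exists m.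
Qed.

Let porbit_on i : i \in C -> porbit s1 i \subset C.
Proof.
move=> iC; apply/subsetP => j /porbitP[m ->]; elim: m => [|m IHm].
  by rewrite expg0 perm1.
by rewrite expgSr permM s1C.
Qed.

Let off_orbits s := [set O in porbits s | ~~ (O \subset C)].

Let off_orbitsP s i : s = s0 \/ s = s1 -> porbit s i \in off_orbits s -> i \notin C.
Proof.
move=> ss; rewrite inE => /andP[_]; apply: contra => iC.
case: ss => ->; last exact: porbit_on.
by rewrite (porbit_in C_orbit).
Qed.

Let off_orbits_eq : off_orbits s1 = off_orbits s0.
Proof.
apply/setP => O; apply/idP/idP => OO; have := OO; rewrite inE => /andP[/imsetP[i _ Oi] _].
  rewrite Oi in OO *; have iC := off_orbitsP (or_intror erefl) OO.
  by move: OO; rewrite porbit_off // !inE imset_f // => /andP[_ ->].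
rewrite Oi in OO *; have iC := off_orbitsP (or_introl erefl) OO.
by move: OO; rewrite -porbit_off // !inE imset_f // => /andP[_ ->].
Qed.

Let off_orbit_disjoint O : O \in off_orbits s0 -> [disjoint O & C].
Proof.
move=> OO; have := OO; rewrite inE => /andP[Oo OC].
rewrite -setI_eq0; apply/eqP/setP => i; rewrite !inE; apply/negP => /andP[iO iC].
by rewrite -(porbit_in Oo iO) (porbit_in C_orbit iC) subxx in OC.
Qed.

Let off_poly O : O \in off_orbits s0 -> orbit_poly s1 O = orbit_poly s0 O.
Proof.
move=> /off_orbit_disjoint dOC; congr (_ - (_ * _%:~R)%:P).
by apply: eq_bigr => i iO; rewrite s01 // (disjointFr dOC).
Qed.

Let Z : seq R := rootsR (\prod_(O in off_orbits s0) orbit_poly s0 O).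

Let sign0 O : orbit_sign s0 O != 0.
Proof. by apply/prodf_neq0 => i _; apply: s0N0. Qed.

Let off_prod_neq0 : \prod_(O in off_orbits s0) orbit_poly s0 O != 0.
Proof.
apply/prodf_neq0 => O; rewrite inE => /andP[Oo _].
by apply: monic_neq0; rewrite /orbit_poly monicXnsubC // (card_porbit_gt0 Oo).
Qed.

Let ZP r : r \in Z -> exists2 O, O \in off_orbits s0 & root (orbit_poly s0 O) r.
Proof. by rewrite /Z rootsR_mem // => /root_prod_mem. Qed.

Let Z_norm r : r \in Z -> r != 0 /\ exists2 O, O \in off_orbits s0 & `|r| = radius O.
Proof.
move=> /ZP[O OO rO]; have := OO; rewrite inE => /andP[Oo _].
have r0 := root_orbit_poly_neq0 (card_porbit_gt0 Oo) (sign0 O) rO.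
by split=> //; exists O => //; exact: root_orbit_poly_norm (card_porbit_gt0 Oo) rO r0.
Qed.

(** As [s0] uses only nonzero entries, [0] is not an eigenvalue, so all real roots are simple and
    the upper bound applies. *)
Let upper : (k <= size Z + size (rootsR (orbit_poly s0 C)))%N.
Proof.
have rootN0 r : root (char_poly (orbit_mx s0)) r -> r != 0.
  rewrite char_poly_orbit_mx => /root_prod_mem[O Oo].
  exact: root_orbit_poly_neq0 (card_porbit_gt0 Oo) (sign0 O).
have := consistent_upper P_consistent (orbit_mx_in_closure s0).
move=> /(_ (fun r rr => char_poly_orbit_mx_simple rr (rootN0 r rr))) /leq_trans; apply.
rewrite -size_cat; apply: uniq_leq_size; first exact: uniq_rootsR.
move=> r; rewrite rootsR_mem ?monic_neq0 ?char_poly_monic // char_poly_orbit_mx.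
move=> /root_prod_mem[O Oo rO]; rewrite mem_cat.
have [OC|OC] := boolP (O \subset C); apply/orP; [right|left].
  have -> : C = O.
    have /imsetP[i _ Oi] := Oo; have iO : i \in O by rewrite Oi porbit_id.
    by rewrite Oi (porbit_in C_orbit) // (subsetP OC).
  by rewrite rootsR_mem // /orbit_poly monic_neq0 // monicXnsubC // (card_porbit_gt0 Oo).
rewrite /Z rootsR_mem //; apply/root_prod_mem; exists O => //.
by rewrite inE Oo.
Qed.

(** Each orbit in [L] has the factor ['X^2] minus the square of its radius, hence two real roots.
    The other orbits of [s1] inside [C] are left out of the count. *)
Let lower : (size Z + 2 * size L <= k)%N.
Proof.
pose s := Z ++ [seq radius D | D <- L] ++ [seq - radius D | D <- L].
have -> : (size Z + 2 * size L = size s)%N.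
  by rewrite !size_cat !size_map mul2n addnn.
have root_pm O r : O \in L -> `|r| = radius O -> root (orbit_poly s1 O) r.
  move=> /LP[_ _ O2 sO] nr; rewrite root_orbit_poly O2 sO mulr1.
  by rewrite -nr real_normK ?num_real.
have root_s r : r \in s -> root (char_poly (orbit_mx s1)) r /\ r != 0.
  rewrite char_poly_orbit_mx !mem_cat => /orP[rZ|].
    have [r0 _] := Z_norm rZ; split=> //.
    have [O OO rO] := ZP rZ; apply/root_prod_mem; exists O; last by rewrite off_poly.
    by move: OO; rewrite -off_orbits_eq inE => /andP[].
  have aux O : O \in L -> `|r| = radius O -> root (\prod_(O in porbits s1) orbit_poly s1 O) r /\ r != 0.
    move=> OL nr; split; last by rewrite -normr_gt0 nr radius_gt0.
    by apply/root_prod_mem; exists O; [case: (LP OL)|exact: root_pm].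
  case/orP => /mapP[O OL rE]; apply: (aux O OL); rewrite rE ?normrN gtr0_norm //;
    exact: radius_gt0.
have us : uniq s.
  rewrite cat_uniq uniq_rootsR cat_uniq !map_inj_uniq ?uL /=; last first.
  - exact: radius_inj.
  - by move=> O O' /oppr_inj /radius_inj.
  rewrite andbT; apply/andP; split; apply/hasPn => r.
    rewrite mem_cat => rL; have [O OL nr] : exists2 O, O \in L & `|r| = radius O.
      by case/orP: rL => /mapP[O OL ->]; exists O;
        rewrite // ?normrN gtr0_norm // radius_gt0.
    apply/negP => /Z_norm[_ [O' OO']]; rewrite nr => /radius_inj OE.
    have [_ OC _ _] := LP OL; move: OO'; rewrite -OE inE => /andP[_].
    by rewrite OC.
  move=> /mapP[O OL ->]; apply/mapP => -[O' _ E].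
  by have := radius_gt0 O; have := radius_gt0 O'; rewrite -E; lra.
apply: (consistent_lower P_consistent (orbit_mx_in_closure s1) us) => r /root_s[rr r0].
by split=> //; apply: char_poly_orbit_mx_simple.
Qed.

(** The orbits off [C] contribute the same roots [Z] to both bounds on [k], and these cancel. *)
Lemma compare_orbit_mx : (2 * size L <= size (rootsR (orbit_poly s0 C)))%N.
Proof. by have := leq_trans lower upper; rewrite leq_add2l. Qed.

End Compare.

Lemma rootsR_orbit_poly_le2 s O : O \in porbits s -> orbit_sign s O != 0 ->
  (size (rootsR (orbit_poly s O)) <= 2)%N.
Proof.
move=> Oo sN0.
apply: (@uniq_leq_size R _ [:: radius O; - radius O] (uniq_rootsR _)) => r rO.
by apply: rootsR_orbit_poly_mem sN0; rewrite ?(card_porbit_gt0 Oo).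
Qed.

(** All real roots have the same absolute value, and an odd power distinguishes a nonzero number
    from its opposite. *)
Lemma rootsR_orbit_poly_odd s O : O \in porbits s -> orbit_sign s O != 0 -> odd #|O| ->
  (size (rootsR (orbit_poly s O)) <= 1)%N.
Proof.
move=> Oo sN0 oddO; have O0 := card_porbit_gt0 Oo.
have p0 : orbit_poly s O != 0 by rewrite monic_neq0 // monicXnsubC.
have := uniq_rootsR (orbit_poly s O).
have sub r : r \in rootsR (orbit_poly s O) -> r ^+ #|O| = radius O ^+ #|O| * (orbit_sign s O)%:~R.
  by rewrite rootsR_mem // root_orbit_poly => /eqP.
have oddI (a b : R) : a ^+ #|O| = b ^+ #|O| -> `|a| = `|b| -> a = b.
  move=> ab /eqP; rewrite eqr_norm2 => /orP[/eqP//|/eqP aE].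
  move: ab; rewrite aE exprNn -signr_odd oddO mulN1r => /eqP.
  rewrite eq_sym -subr_eq0 opprK -mulr2n mulrn_eq0 /= expf_eq0 => /andP[_ /eqP ->].
  by rewrite oppr0.
have nrm r : r \in rootsR (orbit_poly s O) -> `|r| = radius O.
  rewrite rootsR_mem // => rr; exact: root_orbit_poly_norm O0 rr (root_orbit_poly_neq0 O0 sN0 rr).
case: (rootsR _) sub nrm => [|a [|b l]] // sub nrm /andP[+ _].
have aI : a \in [:: a, b & l] by rewrite mem_head.
have bI : b \in [:: a, b & l] by rewrite !inE eqxx orbT.
rewrite inE negb_or => /andP[+ _]; case/eqP.
by apply: (oddI a b); [rewrite (sub a aI) (sub b bI)|rewrite (nrm a aI) (nrm b bI)].
Qed.

Lemma rootsR_orbit_poly_even_neg s O : O \in porbits s -> ~~ odd #|O| -> orbit_sign s O = -1 ->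
  rootsR (orbit_poly s O) = [::].
Proof.
move=> Oo evO sO; have O0 := card_porbit_gt0 Oo.
have p0 : orbit_poly s O != 0 by rewrite monic_neq0 // monicXnsubC.
case E : (rootsR _) => [//|r l].
have : r \in rootsR (orbit_poly s O) by rewrite E mem_head.
rewrite rootsR_mem // root_orbit_poly sO mulrN1 => /eqP rE.
have : 0 <= r ^+ #|O| by rewrite exprn_even_ge0.
by rewrite rE oppr_ge0 leNgt exprn_gt0 // radius_gt0.
Qed.

End OrbitMatrix.

(** * Comparison on one cycle *)

Lemma porbit_swap (T : finType) (s : {perm T}) (x y : T) :
  s x = y -> s y = x -> porbit s x = [set x; y].
Proof.
move=> sx sy; apply/setP => z; rewrite !inE; apply/porbitP/orP => [[m ->]|].
  apply/orP; elim: m => [|m]; first by rewrite expg0 perm1 eqxx.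
  by rewrite expgSr permM => /orP[]/eqP->; rewrite ?sx ?sy eqxx ?orbT.
case=> /eqP->; first by exists 0%N; rewrite expg0 perm1.
by exists 1%N; rewrite expg1.
Qed.

Section CycleOrder.
Variables (n : nat).
Implicit Types (c : seq 'I_n) (x y z : 'I_n).

Lemma next_next_neq c x : uniq c -> 2 < size c -> x \in c -> next c (next c x) != x.
Proof.
move=> uc c3 xc; have [i p cE] := rot_to xc.
rewrite -!(next_rot i uc) cE; have : uniq (rot i c) by rewrite rot_uniq.
have : 2 < size (rot i c) by rewrite size_rot.
rewrite cE; case: p {cE} => [|a [|b l]] //= _ /and4P[xab _ _ _]; rewrite eqxx.
move: xab; rewrite !inE !negb_or => /and3P[xa xb _].
by rewrite [a == x]eq_sym (negPf xa) eqxx eq_sym.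
Qed.

Lemma next3_size c x : uniq c -> 2 < size c -> x \in c ->
  next c (next c (next c x)) = x -> size c = 3.
Proof.
move=> uc c3 xc; have [i p cE] := rot_to xc.
rewrite -!(next_rot i uc) -(size_rot i) cE; have : uniq (rot i c) by rewrite rot_uniq.
have : 2 < size (rot i c) by rewrite size_rot.
rewrite cE; case: p {cE} => [|a [|b [|d l]]] //= _ /and4P[xabd abd bd _]; rewrite eqxx.
move: xabd abd bd; rewrite !inE !negb_or => /and4P[xa xb xd _] /andP[ab _] _.
rewrite [a == x]eq_sym (negPf xa) eqxx [b == x]eq_sym (negPf xb) [b == a]eq_sym (negPf ab) eqxx.
by move=> dx; rewrite dx eqxx in xd.
Qed.

(** Two arcs with the same edge would be successors of each other, which needs a cycle of length
    two. *)
Lemma arc_edge_inj c : uniq c -> 2 < size c -> {in c &, injective (arc_edge c)}.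
Proof.
move=> uc c3 x y xc yc xy; apply/eqP; apply: contraT => Nxy.
have : x \in arc_edge c y by rewrite -xy set21.
have : y \in arc_edge c x by rewrite xy set21.
rewrite !inE eq_sym (negPf Nxy) /= => /eqP yx /eqP xy'.
by have := next_next_neq uc c3 yc; rewrite -xy' -yx eqxx.
Qed.

Lemma arc_edge_meet c x y : uniq c -> x != y -> ~~ [disjoint arc_edge c x & arc_edge c y] ->
  y = next c x \/ x = next c y.
Proof.
move=> uc xy; case/pred0Pn => z /andP[]; rewrite !inE.
case/orP => /eqP->; case/orP => /eqP; [|by right|by left|].
  by move=> e; rewrite e eqxx in xy.
by move=> /(can_inj (prev_next uc)) e; rewrite e eqxx in xy.
Qed.

End CycleOrder.

Section Main.
Variables (R : realType) (n : nat) (P : 'M[sign]_n).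
Hypothesis hsym : combinatorially_symmetric P.
Implicit Types (c : seq 'I_n) (x y z : 'I_n).

Lemma edge_signC x y : edge_sign P x y = edge_sign P y x.
Proof. exact: mulrC. Qed.

Lemma edge_sign_cases x y : adj P x y -> edge_sign P x y = 1%R \/ edge_sign P x y = (-1)%R.
Proof.
move=> xy; have := xy; rewrite (adj_sym hsym) => /andP[_]; case/andP: xy => _.
rewrite /edge_sign; case: (P x y) => //; case: (P y x) => //= _ _; by [left|right].
Qed.

Lemma positive_arcP c x : graph_cycle P c -> x \in c ->
  positive_arc P c x <-> edge_sign P x (next c x) = 1%R.
Proof.
move=> gc xc; rewrite /positive_arc.
by case: (edge_sign_cases (graph_cycle_adj gc xc)) => ->.
Qed.

Lemma Npositive_arcP c x : graph_cycle P c -> x \in c ->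
  ~~ positive_arc P c x -> edge_sign P x (next c x) = (-1)%R.
Proof.
move=> gc xc; rewrite /positive_arc.
by case: (edge_sign_cases (graph_cycle_adj gc xc)) => ->.
Qed.

Lemma graph_cycle_rev c : graph_cycle P c -> graph_cycle P (rev c).
Proof.
case=> c3 /andP[cc uc]; split; first by rewrite size_rev.
rewrite /ucycle rev_uniq uc andbT rev_cycle.
by rewrite (eq_cycle (e' := adj P)) // => x y; rewrite (adj_sym hsym).
Qed.

Variable k : nat.
Hypothesis P_consistent :
  forall A : 'M[R]_n, qualitative_class P A -> num_real_eigenvalues A = k.

(** The product depends on the direction in which [c] is listed. *)
Definition cycle_weight c : int := (\prod_(x in [set x in c]) (P x (next c x) : int))%R.

(** * Swaps along positive edges against the tour around the cycle *)

Section OneCycle.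
Variables (c : seq 'I_n) (rho : 'I_n -> 'I_n).
Hypothesis gc : graph_cycle P c.
Hypothesis rho_inj : {in [predC c] &, injective rho}.
Hypothesis rhoP : forall x, x \notin c -> adj P x (rho x) /\ rho x \notin c.

Let uc : uniq c := graph_cycle_uniq gc.

Lemma glue_perm (f : 'I_n -> 'I_n) : {in c &, injective f} -> (forall x, x \in c -> f x \in c) ->
  exists s : 'S_n, forall x, s x = if x \in c then f x else rho x.
Proof.
move=> f_inj fc; have inj : injective (fun x => if x \in c then f x else rho x).
  move=> x y; case: ifPn => xc; case: ifPn => yc xy.
  - exact: f_inj.
  - by have [_] := rhoP yc; rewrite -xy fc.
  - by have [_] := rhoP xc; rewrite xy fc.
  - exact: rho_inj.
by exists (perm inj) => x; rewrite permE.
Qed.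

Lemma cycle_perm : exists s0 : 'S_n,
  [/\ forall x, s0 x = if x \in c then next c x else rho x,
      [set x in c] \in porbits s0, #|[set x in c]| = size c,
      orbit_sign P s0 [set x in c] = cycle_weight c &
      forall x, ((P x (s0 x) : int) != 0)%R].
Proof.
have [s0 s0E] : exists s : 'S_n, forall x, s x = if x \in c then next c x else rho x.
  apply: glue_perm => [x y _ _|x]; last by rewrite mem_next.
  exact: (can_inj (prev_next uc)).
exists s0; split=> //.
- have [x xc] : exists x, x \in c.
    by case: gc => c3 _; case: (c) c3 => // x l _; exists x; apply: mem_head.
  apply/imsetP; exists x => //; apply/setP => y; rewrite inE.
  have it m : (s0 ^+ m)%g x = iter m (next c) x /\ iter m (next c) x \in c.
    elim: m => [|m [IH1 IH2]]; first by rewrite expg0 perm1.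
    by rewrite expgSr permM IH1 s0E IH2 /= mem_next IH2.
  rewrite -(fconnect_cycle (cycle_next uc) xc); apply/idP/porbitP => [xy|[m ->]].
    by exists (findex (next c) x y); have [-> _] := it (findex (next c) x y); rewrite iter_findex.
  by have [-> _] := it m; apply: fconnect_iter.
- by rewrite cardsE (card_uniqP uc).
- by apply: eq_bigr => x; rewrite inE => xc; rewrite s0E xc.
- move=> x; rewrite s0E; case: ifPn => xc; first by case/andP: (graph_cycle_adj gc xc).
  by case: (rhoP xc) => /andP[].
Qed.

(** Here [t] swaps the ends of the edges given by [xs]. Glued with [rho], it is compared with the
    tour around [c]: each positive edge swapped yields two real eigenvalues, and the tour at most
    [2], [1] or [0]. *)
Lemma matching_bound (t : 'S_n) (xs : seq 'I_n) :
    (forall x, x \in c -> t x \in c) ->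
    (forall x, x \in xs -> [/\ x \in c, positive_arc P c x, t x = next c x & t (next c x) = x]) ->
    uniq [seq arc_edge c x | x <- xs] ->
  [/\ 2 * size xs <= 2, odd (size c) -> 2 * size xs <= 1 &
      ~~ odd (size c) -> cycle_weight c = (-1)%R -> 2 * size xs <= 0].
Proof.
move=> tc xsP uxs; have [s0 [s0E C_orb cardC signC s0N0]] := cycle_perm.
have [s1 s1E] := glue_perm (in2W (@perm_inj _ t)) tc.
have bound : 2 * size xs <= size (rootsR (orbit_poly R P s0 [set x in c])).
  rewrite -(size_map (arc_edge c)); apply: (compare_orbit_mx (s1 := s1) P_consistent) => //.
  - by move=> x; rewrite inE s0E s1E => /negPf->.
  - by move=> x; rewrite !inE => xc; rewrite s1E xc tc.
  move=> _ /mapP[x xxs ->]; have [xc px tx tnx] := xsP x xxs.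
  have nc : next c x \in c by rewrite mem_next.
  have xn : x != next c x by case/andP: (graph_cycle_adj gc xc).
  have orbE : porbit s1 x = arc_edge c x by apply: porbit_swap; rewrite s1E ?xc ?nc.
  split.
  - by rewrite -orbE imset_f.
  - by apply/subsetP => y; rewrite !inE => /orP[]/eqP->.
  - by rewrite cards2 xn.
  rewrite /orbit_sign big_setU1 ?inE //= big_set1 !s1E xc nc tx tnx.
  by apply/(positive_arcP gc xc).
have sN0 : orbit_sign P s0 [set x in c] != 0%R.
  by apply/prodf_neq0 => x _; apply: s0N0.
split.
- exact: leq_trans bound (rootsR_orbit_poly_le2 _ C_orb sN0).
- by move=> oc; apply: leq_trans bound (rootsR_orbit_poly_odd _ C_orb sN0 _); rewrite cardC.
move=> ec wc; apply: leq_trans bound _.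
by rewrite rootsR_orbit_poly_even_neg ?cardC ?signC.
Qed.

Lemma tperm_next_stable x : x \in c -> forall y, y \in c -> tperm x (next c x) y \in c.
Proof. by move=> xc y yc; case: tpermP => // _; rewrite ?mem_next. Qed.

(** Disjoint edges can be swapped simultaneously, and two of them would give [4 <= 2] in
    [matching_bound]. *)
Lemma nonadjacent_positive_false : ~ two_nonadjacent_positive_edges P c.
Proof.
move=> [x [y [xc yc px py dis]]].
have xn : x != next c x by case/andP: (graph_cycle_adj gc xc).
have yn : y != next c y by case/andP: (graph_cycle_adj gc yc).
have := dis; rewrite disjoints_subset => /subsetP sub.
have := sub x; rewrite !inE eqxx => /(_ isT); rewrite negb_or => /andP[xy xny].
have := sub (next c x); rewrite !inE eqxx orbT => /(_ isT); rewrite negb_or => /andP[nxy nxny].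
have [|||//] := @matching_bound (tperm x (next c x) * tperm y (next c y))%g [:: x; y].
- by move=> z zc; rewrite permM !tperm_next_stable.
- move=> z; rewrite !inE => /orP[]/eqP->; split=> //; rewrite !permM.
  + by rewrite tpermL tpermD // eq_sym.
  + by rewrite tpermR tpermD // eq_sym.
  + by rewrite (tpermD xy nxy) tpermL.
  + by rewrite (tpermD xny nxny) tpermR.
rewrite /= inE andbT; apply: contraTneq dis => ->.
by rewrite -setI_eq0 setIid; apply/set0Pn; exists y; rewrite set21.
Qed.

Lemma odd_positive_false x : odd (size c) -> x \in c -> ~ positive_arc P c x.
Proof.
move=> oc xc px; have [|||_ /(_ oc)] // := @matching_bound (tperm x (next c x)) [:: x].
- exact: tperm_next_stable.
- by move=> z; rewrite inE => /eqP->; rewrite tpermL tpermR.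
Qed.

Lemma negative_weight_false x : ~~ odd (size c) -> cycle_weight c = (-1)%R ->
  x \in c -> ~ positive_arc P c x.
Proof.
move=> ec wc xc px; have [|||_ _ /(_ ec wc)] // := @matching_bound (tperm x (next c x)) [:: x].
- exact: tperm_next_stable.
- by move=> z; rewrite inE => /eqP->; rewrite tpermL tpermR.
Qed.

End OneCycle.

(** * Runs of equal sign and the two products around a cycle *)

Section Runs.
Variable c : seq 'I_n.
Hypothesis gc : graph_cycle P c.
Let uc : uniq c := graph_cycle_uniq gc.
Let c3 : 2 < size c. Proof. by case: gc. Qed.

Lemma signed_run_rot m (l : nat) (s : int) : 0 < l ->
    (forall x, x \in take l (rot m c) -> edge_sign P x (next c x) = s) ->
  signed_run P c [set arc_edge c x | x in take l (rot m c)].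
Proof. by move=> l0 sE; exists m, l, s. Qed.

(** If all edges were negative, the whole cycle would be a run containing every other, hence the
    only maximal one. *)
Lemma several_runs_positive : several_odd_maximal_signed_paths P c ->
  exists2 x, x \in c & positive_arc P c x.
Proof.
move=> [F1 [F2 [[r1 max1] [r2 max2] F12 _ _]]]; apply: contrapT => Npos.
have run : signed_run P c (cycle_edges c).
  have := @signed_run_rot 0 (size c) (-1)%R; rewrite rot0 take_size; apply.
    exact: leq_trans c3.
  move=> x xc; apply: Npositive_arcP => //.
  by apply/negP => px; apply: Npos; exists x.
have sub F : signed_run P c F -> F \subset cycle_edges c.
  move=> [i [l [s [_ -> _]]]]; apply/subsetP => _ /imsetP[x /mem_take xc ->].
  by apply: imset_f; rewrite mem_rot in xc.
by apply: F12; rewrite -(max1 _ run (sub _ r1)) -(max2 _ run (sub _ r2)).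
Qed.

(* The only maximal runs have lengths [2] and [size c - 2]. *)
Lemma two_consecutive_positive_runs x F : ~~ odd (size c) -> x \in c ->
    (forall z, z \in c -> positive_arc P c z = (z \in [:: x; next c x])) ->
  maximal_signed_path P c F -> ~~ odd #|F|.
Proof.
move=> ec xc pos [run_F max_F]; have [i p cE] := rot_to xc.
have [y [q pE]] : exists y q, p = y :: q.
  case: p cE => [|y q] cE; last by exists y, q.
  by have := c3; rewrite -(size_rot i) cE.
have size_q : size c = (size q).+2 by rewrite -(size_rot i) cE pE.
(* The cycle is rotated to start at [x]: the arcs at [x] and [y] are the positive ones, those at [q]
   the negative ones. *)
have y_next : y = next c x by rewrite -(next_rot i uc) cE pE /= eqxx.
have urot : uniq [:: x, y & q] by rewrite -pE -cE rot_uniq.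
have memc z : (z \in c) = (z \in [:: x, y & q]) by rewrite -pE -cE mem_rot.
pose D := [set arc_edge c z | z in [:: x; y]].
pose E := [set arc_edge c z | z in q].
have cardD (r : seq 'I_n) : uniq r -> {subset r <= c} -> #|[set arc_edge c z | z in r]| = size r.
  move=> ur rc; rewrite card_in_imset ?(card_uniqP ur) // => a b ar br.
  by apply: arc_edge_inj; rewrite ?rc.
have D_even : ~~ odd #|D|.
  rewrite cardD //; first by move: urot; rewrite /= !inE negb_or => /and3P[/andP[-> _]].
  by move=> z; rewrite memc !inE => /orP[]->; rewrite ?orbT.
have E_even : ~~ odd #|E|.
  rewrite cardD; first by rewrite size_q /= negbK in ec.
    by move: urot => /= /and3P[].
  by move=> z zq; rewrite memc !inE zq !orbT.
have run_D : signed_run P c D.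
  have := @signed_run_rot i 2 1%R; rewrite cE pE /= take0; apply=> // z zxy.
  have zc : z \in c by move: zxy; rewrite memc !inE => /orP[]->; rewrite ?orbT.
  by apply/(positive_arcP gc zc); rewrite pos // -y_next.
have q_neg z : z \in q -> edge_sign P z (next c z) = (-1)%R.
  move=> zq; have zc : z \in c by rewrite memc !inE zq !orbT.
  apply: Npositive_arcP => //; rewrite pos // -y_next !inE.
  apply/negP => /orP[]/eqP zE; move: urot; rewrite -zE /= !inE zq ?orbT //=.
  by rewrite andbF.
have run_E : 0 < size q -> signed_run P c E.
  move=> q0; have := @signed_run_rot (rot_add c i 2) (size q) (-1)%R q0.
  rewrite -rot_rot_add cE pE /rot /= drop0 take_size_cat //; exact.
have [m [l [s [l0 FE sE]]]] := run_F.
have sub_c z : z \in take l (rot m c) -> z \in c by move/mem_take; rewrite mem_rot.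
(* A run of sign [1] lies in [D], any other in [E]; maximality makes it equal to that set. *)
have [s1|s1] := eqVneq s 1%R.
  suff -> : F = D by [].
  apply/esym/max_F => //; rewrite FE; apply/subsetP => _ /imsetP[z zt ->].
  apply: imset_f; rewrite y_next -pos ?sub_c //.
  by apply/(positive_arcP gc (sub_c z zt)); rewrite sE.
have tq z : z \in take l (rot m c) -> z \in q.
  move=> zt; have zc := sub_c z zt; have := zc; rewrite memc !inE => /or3P[zx|zy|//].
    case/eqP: s1; rewrite -(sE z zt); apply/(positive_arcP gc zc).
    by rewrite pos // !inE zx.
  case/eqP: s1; rewrite -(sE z zt); apply/(positive_arcP gc zc).
  by rewrite pos // !inE -y_next zy orbT.
suff -> : F = E by [].
apply/esym/max_F; last by rewrite FE; apply/subsetP => _ /imsetP[z /tq zq ->]; apply: imset_f.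
(* [E] is a run only if [q] is not empty, which follows because [F] is a nonempty run with arcs in
   [q]. *)
apply: run_E; have : 0 < size (take l (rot m c)).
  by rewrite size_take size_rot; case: ifP => // _; apply: leq_trans c3.
by case: (take l (rot m c)) tq => // z t /(_ z (mem_head _ _)) + _; case: (q).
Qed.

(** Any two positive edges meet. If two are consecutive, a third would close a triangle, against
    even length; so they are the only ones, and then every maximal run has even length. *)
Lemma even_runs_unique_positive x : ~~ odd (size c) -> x \in c -> positive_arc P c x ->
    ~ two_nonadjacent_positive_edges P c -> several_odd_maximal_signed_paths P c ->
  forall y, y \in c -> positive_arc P c y -> y = x.
Proof.
move=> ec xc px Nadj [F1 [F2 [max1 _ _ odd1 _]]].
have meet a b : a \in c -> b \in c -> positive_arc P c a -> positive_arc P c b ->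
    a != b -> b = next c a \/ a = next c b.
  move=> ac bc pa pb ab; apply: arc_edge_meet => //.
  by apply/negP => dis; apply: Nadj; exists a, b.
have no_next a : a \in c -> positive_arc P c a -> positive_arc P c (next c a) -> False.
  move=> ac pa pn; suff : ~~ odd #|F1| by rewrite odd1.
  apply: (two_consecutive_positive_runs ec ac) max1 => z zc.
  apply/idP/idP => [pz|]; last by rewrite !inE => /orP[]/eqP->.
  rewrite !inE; apply: contraT; rewrite negb_or => /andP[za zn].
  have nc : next c a \in c by rewrite mem_next.
  have [e|az] := meet a z ac zc pa pz ltac:(by rewrite eq_sym).
    by rewrite e eqxx in zn.
  have [e|e] := meet (next c a) z nc zc pn pz ltac:(by rewrite eq_sym).
    have := next3_size uc c3 ac; rewrite -e -az => /(_ erefl) s3.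
    by rewrite s3 in ec.
  have := can_inj (prev_next uc) e => ez.
  by rewrite ez eqxx in za.
move=> y yc py; apply/eqP; apply: contraT => yx.
have [e|e] := meet y x yc xc py px yx.
  by case: (no_next y yc py); rewrite -e.
by case: (no_next x xc px); rewrite -e.
Qed.

(** The two directions use the two opposite entries of each edge; [next] reindexes the reversed
    product. *)
Lemma cycle_weight_rev :
  (cycle_weight c * cycle_weight (rev c) = \prod_(x in [set x in c]) edge_sign P x (next c x))%R.
Proof.
rewrite big_split /=; congr (_ * _)%R.
rewrite /cycle_weight (reindex_inj (can_inj (prev_next uc))) /=.
apply: eq_big => [x|x _]; first by rewrite !inE mem_rev mem_next.
by rewrite (next_rev uc) prev_next.
Qed.

Lemma cycle_weight_abs : (cycle_weight c = 1 \/ cycle_weight c = -1)%R.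
Proof.
rewrite /cycle_weight; apply: (big_ind (fun w : int => w = 1 \/ w = -1)%R) => [|a b|x].
- by left.
- by case=> -> [] ->; [left|right|right|left].
rewrite inE => xc; case/andP: (graph_cycle_adj gc xc) => _.
by case: (P _ _) => // _; [left|right].
Qed.

(** The product of the edge signs has [size c - 1] negative factors, an odd number. *)
Lemma unique_positive_weight x : ~~ odd (size c) -> x \in c -> positive_arc P c x ->
    (forall y, y \in c -> positive_arc P c y -> y = x) ->
  (cycle_weight c * cycle_weight (rev c) = -1)%R.
Proof.
move=> ec xc px uniq_x; rewrite cycle_weight_rev.
have xS : x \in [set x in c] by rewrite inE.
rewrite (bigD1 x) //= ((positive_arcP gc xc).1 px) mul1r.
rewrite (eq_bigr (fun=> (-1)%R)) => [|y /andP[yc yx]]; last first.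
  rewrite inE in yc; apply: Npositive_arcP => //.
  by apply: contra yx => /(uniq_x y yc) ->.
rewrite prodr_const -signr_odd.
have -> : odd #|[pred y | y \in [set x in c] & y != x]| = true; last by rewrite expr1.
have := cardsD1 x [set x in c]; rewrite xS cardsE (card_uniqP uc) => sE.
rewrite sE /= negbK in ec; rewrite -[RHS]ec; congr (odd _).
by apply: eq_card => y; rewrite !inE andbC.
Qed.

End Runs.

End Main.

Theorem theorem4p19 (R : realType) (n : nat) (P : 'M[sign]_n)
  (hirr : irreducible_pattern P)
  (hsym : combinatorially_symmetric P)
  (hdiag : zero_diagonal P)
  (hcycle : exists c : seq 'I_n, graph_cycle P c)
  (hleaf : forall i : 'I_n, ~ leaf P i)
  (hodd : odd_path_adjacent_distances P)
  (hcond : (exists c : seq 'I_n,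
              graph_cycle P c /\ two_nonadjacent_positive_edges P c)
        \/ (exists c : seq 'I_n,
              graph_cycle P c /\ several_odd_maximal_signed_paths P c)
        \/ (exists c : seq 'I_n,
              graph_cycle P c /\ odd_with_positive_edge P c)) :
  ~ consistent R P.
Proof.
case=> k Pk.
have nonadj c : graph_cycle P c -> ~ two_nonadjacent_positive_edges P c.
  move=> gc; have [rho [rho_inj rhoP]] := off_cycle_factor hsym hirr hleaf hcycle hodd gc.
  exact: (nonadjacent_positive_false hsym Pk gc rho_inj rhoP).
have odd_pos c x : graph_cycle P c -> odd (size c) -> x \in c -> ~ positive_arc P c x.
  move=> gc; have [rho [rho_inj rhoP]] := off_cycle_factor hsym hirr hleaf hcycle hodd gc.
  exact: (odd_positive_false hsym Pk gc rho_inj rhoP).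
have neg c x : graph_cycle P c -> ~~ odd (size c) -> cycle_weight P c = (-1)%R ->
    x \in c -> ~ positive_arc P c x.
  move=> gc; have [rho [rho_inj rhoP]] := off_cycle_factor hsym hirr hleaf hcycle hodd gc.
  exact: (negative_weight_false hsym Pk gc rho_inj rhoP).
case: hcond => [[c [gc]]|[[c [gc runs]]|[c [gc [oc [x [xc px]]]]]]].
- exact: nonadj.
- have [x xc px] := several_runs_positive hsym gc runs.
  have [oc|ec] := boolP (odd (size c)); first exact: (odd_pos c x).
  have ux := even_runs_unique_positive hsym gc ec xc px (nonadj c gc) runs.
  have gr := graph_cycle_rev hsym gc; have uc := graph_cycle_uniq gc.
  have := unique_positive_weight hsym gc ec xc px ux.
  (* One of the two directions around [c] has weight [-1], and the contradiction comes from that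
     direction. *)
  have [w1|] := cycle_weight_abs gc; last by move=> w _; apply: (neg c x).
  (* In the reversed list the positive edge starts at its other end [next c x]. *)
  rewrite w1 mul1r => wr; apply: (neg (rev c) (next c x)) => //.
  + by rewrite size_rev.
  + by rewrite mem_rev mem_next.
  by rewrite /positive_arc (next_rev uc) prev_next // edge_signC.
exact: (odd_pos c x).
Qed.
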